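(* Let $v=(x_0,y_0)\in\mathbb{R}^2$, let $\gamma:[0,L]\to\mathbb{R}^2$ be the unit-speed parametrization of the (possibly) curved side of a mesh element $\Delta$ whose vertex opposite to that side is $v$, and let $r_0(s)$ and $\theta(s)$ be the radius and polar angle of $\gamma(s)$ with respect to polar coordinates centered at $v$, so that $$\Delta=\bigl\{(x_0+r\cos(\theta(s)),\,y_0+r\sin(\theta(s))) : 0\le s\le L,\ 0\le r\le r_0(s)\bigr\}.$$ Let $f:\Delta\to\mathbb{R}$ be a function such that $y\mapsto\log(\lVert v-y\rVert)\,f(y)$ is integrable over $\Delta$. Suppose further that $\theta(s)$ is strictly monotone on $[0,L]$. Then $$\iint_{\Delta}\log(\lVert v-y\rVert)f(y)\,\mathrm{d}A_y=\int_0^L\Bigl(\int_0^1\log(r_0(s)\tilde r)\, f\bigl(y(\tilde r,s)\bigr)\,\tilde r\,\mathrm{d}\tilde r\Bigr)\,\bigl|(\gamma(s)-v)\times\gamma'(s)\bigr|\,\mathrm{d}s,$$ where $$y(\tilde r,s)=\begin{pmatrix}x_0+r_0(s)\tilde r\cos(\theta(s))\\ y_0+r_0(s)\tilde r\sin(\theta(s))\end{pmatrix}.$$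
   Context: A mesh element is a closed planar region with three sides that is either a triangle or a curved element, i.e. a region bounded by a simple closed curve consisting of two straight segments and one smooth curved side. Here $v$ is the vertex common to the two straight sides, and $\gamma:[0,L]\to\mathbb{R}^2$ is the smooth, arc-length ($\lVert\gamma'(s)\rVert=1$) parametrization of the third side (called the curved side even if it is a line segment), which does not pass through $v$. The functions $r_0:[0,L]\to(0,\infty)$ and $\theta:[0,L]\to\mathbb{R}$ are the radius $r_0(s)=\lVert\gamma(s)-v\rVert$ and a continuous choice of polar angle, so that $\gamma(s)=v+r_0(s)(\cos\theta(s),\sin\theta(s))$. Since $\Delta$ is a mesh element with two straight sides meeting at $v$, the total angle $|\theta(L)-\theta(0)|$ is less than $2\pi$ when $\theta$ is monotone. For planar vectors $a=(a_1,a_2)$ and $b=(b_1,b_2)$, $|a\times b|=|a_1b_2-a_2b_1|$. $\lVert\cdot\rVert$ is the Euclidean norm and $\mathrm{d}A_y$ is the area element. *)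

(* Defs.v *)
From HB Require Import structures.
From mathcomp Require Import all_boot all_order all_algebra.
From mathcomp Require Import all_classical all_reals all_analysis.

Set Implicit Arguments.
Unset Strict Implicit.
Unset Printing Implicit Defensive.

Import Order.TTheory GRing.Theory Num.Theory.
Import numFieldNormedType.Exports.

Local Open Scope classical_set_scope.
Local Open Scope ring_scope.

(* The library norm on R * R is the sup norm. *)
Definition enorm (R : realType) (a : R * R) : R :=
  Num.sqrt (a.1 ^+ 2 + a.2 ^+ 2).

Definition cross (R : realType) (a b : R * R) : R := a.1 * b.2 - a.2 * b.1.

Definition polar (R : realType) (v : R * R) (r t : R) : R * R :=
  (v.1 + r * cos t, v.2 + r * sin t).

(* Difference quotients only use points of A: on a segment, the derivative is
   one-sided at the endpoints. *)
Definition derivable_within (R : realType) (V : normedModType R)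
    (A : set R) (g : R -> V) (s : R) : Prop :=
  cvg (h^-1 *: (g (h + s) - g s) @[h --> within [set h | A (h + s)] 0^']).

Definition derive_within (R : realType) (V : normedModType R)
    (A : set R) (g : R -> V) (s : R) : V :=
  lim (h^-1 *: (g (h + s) - g s) @[h --> within [set h | A (h + s)] 0^']).

(* C^infinity on A. *)
Definition smooth_on (R : realType) (V : normedModType R)
    (A : set R) (g : R -> V) : Prop :=
  forall (n : nat) (s : R), A s ->
    derivable_within A (iter n (derive_within A) g) s.

Definition simple_closed_curve (R : realType) (T : topologicalType)
    (a b : R) (c : R -> T) : Prop :=
  [/\ {within `[a, b], continuous c}, c a = c b & {in `[a, b[ &, injective c}].

(* Inside of a Jordan curve J: the bounded part of the complement of J. *)
Definition inside (R : realType) (J : set (R * R)) : set (R * R) :=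
  [set p | ~ J p /\ bounded_set (connected_component (~` J) p)].

(* The segment from v to gamma 0, then gamma, then the segment from gamma L
   to v, run through as the parameter goes from 0 to L + 2. *)
Definition mesh_boundary (R : realType) (v : R * R) (L : R)
    (gamma : R -> R * R) (t : R) : R * R :=
  if t <= 1 then v + t *: (gamma 0 - v)
  else if t <= 1 + L then gamma (t - 1)
  else gamma L + (t - 1 - L) *: (v - gamma L).

(* Triangles are the case where gamma parametrizes a line segment. That v is
   not on gamma, and that the sides are nondegenerate, follows from the
   boundary being a simple closed curve. *)
Definition mesh_element (R : realType) (Delta : set (R * R)) (v : R * R)
    (L : R) (gamma : R -> R * R) : Prop :=
  let J := mesh_boundary v L gamma @` `[0, L + 2] in
  [/\ 0 < L,
      smooth_on `[0, L] gamma,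
      (forall s : R, s \in `[0, L] -> enorm (derive_within `[0, L] gamma s) = 1),
      simple_closed_curve 0 (L + 2) (mesh_boundary v L gamma) &
      Delta = J `|` inside J].

(* Planar Lebesgue measure on all Lebesgue (not only Borel) measurable sets:
   the Caratheodory completion of the product of the Borel measures. *)
Definition lebesgue_measure2 (R : realType) :=
  @completed_measure_extension _ (measurableTypeR R * measurableTypeR R)%type R
    (@lebesgue_measure R \x @lebesgue_measure R)%E.

HB.instance Definition _ (R : realType) := Measure.on (@lebesgue_measure2 R).

(* Main.v *)
(** The map (r, s) |-> v + r (gamma s - v) is inverted one coordinate at a
    time, so that Tonelli's theorem and substitutions in one variable suffice.
    On each side of the vertical line through v, a point (x, y) is described
    by x and the slope m = (y - v.2) / (x - v.1), with dy = |x - v.1| dm.  If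
    m is the slope of gamma s - v, then x - v.1 = r (gamma s - v).1 turns the
    integral over x into the radial integral, and
    dm / ds = cross (gamma s - v) (gamma' s) / ((gamma s - v).1)^2
    turns the integral over m into the integral over s.  The slope determines
    s because theta turns by less than 2 pi: if it made a full turn, then one
    turn later the radius would be larger than r0 0 at the start (the curve
    avoids the first straight side) and, one turn earlier, larger than r0 L at
    the end (it avoids the last one), so that by the intermediate value
    theorem the curve would meet itself.  Finally, a function measurable for
    the completed measure is Borel off a null set, and the formula applied to
    this null set shows that almost every ray on which the Jacobian does not
    vanish meets it in a null set. *)

Require Import Defs.
From HB Require Import structures.
From mathcomp Require Import all_boot all_order all_algebra.
From mathcomp Require Import all_classical all_reals all_analysis.
From mathcomp Require Import measurable_realfun.
From mathcomp Require Import ring lra.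

Import Order.TTheory GRing.Theory Num.Theory.
Import numFieldNormedType.Exports.

Local Open Scope classical_set_scope.
Local Open Scope ring_scope.

(** * Substitution in one variable *)

(** The image under [phi] of the measure with density [g] on [D], packed as a measure: disjoint sets
    have disjoint preimages, and the integral of a nonnegative function is countably additive in its
    domain. *)
Lemma density_pushforward d d' (T : measurableType d) (T' : measurableType d')
    (R : realType) (mu : {measure set T -> \bar R}) (D : set T) (phi : T -> T')
    (g : T -> \bar R) :
  measurable D -> measurable_fun D phi -> measurable_fun D g ->
  (forall x, D x -> (0 <= g x)%E) ->
  exists nu : {measure set T' -> \bar R},
    forall B, nu B = (\int[mu]_(x in D `&` phi @^-1` B) g x)%E.
Proof.
move=> mD mphi mg g0.
pose nu B := (\int[mu]_(x in D `&` phi @^-1` B) g x)%E.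
have nu0 : nu set0 = 0%E by rewrite /nu preimage_set0 setI0 integral_set0.
have nu_ge0 B : (0 <= nu B)%E by apply: integral_ge0 => x [Dx _]; exact: g0.
have nuS : semi_sigma_additive nu.
  move=> F mF tF mUF.
  rewrite /nu preimage_bigcup setI_bigcupr ge0_integral_bigcup.
  - by apply: is_cvg_nneseries => n _ _; exact: nu_ge0.
  - by move=> k; exact: mphi.
  - apply: measurable_funS mg => //.
    by apply: bigcup_sub => k _; exact: subIsetl.
  - by move=> x [k _ [Dx _]]; exact: g0.
  - apply/trivIsetP => i j _ _ ij; rewrite setIACA setIid -preimage_setI.
    by move/trivIsetP : tF => ->//; rewrite preimage_set0 setI0.
pose mix := isMeasure.Build _ _ _ nu nu0 nu_ge0 nuS.
pose nuM : {measure set T' -> \bar R} := HB.pack nu mix.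
by exists nuM.
Qed.

Section density.
Import HBNNSimple.

(** Both sides are limits along simple functions increasing to [f], by monotone convergence. By
    linearity it remains to treat the indicator of a measurable set, where the claim is [nuE]. *)
Lemma ge0_integral_density d d' (T : measurableType d) (T' : measurableType d')
    (R : realType) (mu : {measure set T -> \bar R})
    (nu : {measure set T' -> \bar R}) (D : set T) (phi : T -> T')
    (g : T -> R) (B : set T') (f : T' -> \bar R) :
  measurable D -> measurable_fun D phi -> measurable_fun D g ->
  (forall x, D x -> 0 <= g x) ->
  (forall A, measurable A ->
    nu A = (\int[mu]_(x in D `&` phi @^-1` A) (g x)%:E)%E) ->
  measurable B -> measurable_fun B f -> (forall y, B y -> (0 <= f y)%E) ->
  (\int[nu]_(y in B) f y =
   \int[mu]_(x in D `&` phi @^-1` B) (f (phi x) * (g x)%:E))%E.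
Proof.
move=> mD mphi mg g0 nuE mB mf f0.
pose h := nnsfun_approx mB mf.
set E := D `&` phi @^-1` B.
have mE : measurable E by exact: mphi.
have ED : E `<=` D by exact: subIsetl.
have mgE : measurable_fun E (EFin \o g).
  by apply/measurable_EFinP; exact: measurable_funS mg.
have mphiE : measurable_fun E phi by exact: measurable_funS mphi.
have -> : (\int[nu]_(x in B) f x =
    lim (\int[nu]_(x in B) (h n x)%:E @[n --> \oo]))%E.
  have fE x : B x -> f x = lim ((EFin \o h n) x @[n --> \oo]).
    by move=> Ex; apply/esym/cvg_lim => //; exact: cvg_nnsfun_approx.
  under eq_integral => x /[!inE] /fE -> //.
  apply: monotone_convergence => //.
  - by move=> n; apply/measurable_EFinP; exact: measurable_funTS.
  - by move=> n x Ex //=; rewrite lee_fin.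
  - by move=> x Ex a b ab; rewrite lee_fin; exact/lefP/nd_nnsfun_approx.
have -> : (\int[mu]_(x in E) (f (phi x) * (g x)%:E) =
    lim (\int[mu]_(x in E) ((h n (phi x))%:E * (g x)%:E) @[n --> \oo]))%E.
  have fg x : E x -> (f (phi x) * (g x)%:E =
      lim ((h n (phi x))%:E * (g x)%:E @[n --> \oo]))%E.
    move=> [Dx Bx]; apply/esym/cvg_lim => //; apply: cvgeZr => //.
    exact: cvg_nnsfun_approx.
  under eq_integral => x /[!inE] /fg -> //.
  apply: monotone_convergence => [//| | |].
  - move=> n; apply: emeasurable_funM => //.
    by apply/measurable_EFinP; exact: measurableT_comp.
  - by move=> n x [Dx _] /=; rewrite mule_ge0 ?lee_fin ?g0.
  - move=> x [Dx _] a b ab/=; rewrite lee_wpmul2r ?lee_fin ?g0//.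
    exact/lefP/nd_nnsfun_approx.
congr (lim (_ @ \oo)); apply/funext => n.
under [LHS]eq_integral do rewrite fimfunE -fsumEFin//.
rewrite ge0_integral_fsum//; last 2 first.
- move=> r; apply/measurable_EFinP/measurable_funM => //.
- by move=> r y By; rewrite EFinM nnfun_muleindic_ge0.
under [RHS]eq_integral => x xE.
  rewrite fimfunE -fsumEFin// ge0_mule_fsuml; last first.
    by move=> y; rewrite EFinM nnfun_muleindic_ge0.
  over.
rewrite ge0_integral_fsum//; last 2 first.
- move=> r; apply: emeasurable_funM => //.
  apply/measurable_EFinP/measurable_funM => //.
  exact: measurableT_comp.
- by move=> r y [Dy _]; rewrite mule_ge0 ?lee_fin ?g0// -lee_fin EFinM nnfun_muleindic_ge0.
apply: eq_fsbigr => r /set_mem[t _ <-].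
under eq_integral do rewrite EFinM.
rewrite ge0_integralZl//; last 2 first.
- by apply/measurable_EFinP; exact: measurable_indic.
- by rewrite lee_fin.
rewrite integral_indic// nuE; last exact: measurableI.
under [RHS]eq_integral do rewrite EFinM -muleA.
rewrite ge0_integralZl//; last 3 first.
- apply: emeasurable_funM => //.
  by apply/measurable_EFinP; apply: measurableT_comp => //; exact: measurable_indic.
- by move=> x [Dx _]; rewrite mule_ge0// lee_fin ?g0.
- by rewrite lee_fin.
congr (_ * _)%E.
rewrite preimage_setI [_ `&` phi @^-1` B]setIC setIA integral_mkcondr.
apply: eq_integral => x _; rewrite patchE indicE.
rewrite -[x \in _]/(phi x \in h n @^-1` [set h n t]).
by case: ifP => _; rewrite ?mul1e ?mul0e.
Qed.

End density.

Section substitution.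
Context {R : realType}.
Notation mu := (@lebesgue_measure R).
Implicit Types (phi dphi : R -> R).

(* The right-hand side, plus Lebesgue measure off the image of phi, is a measure
   that agrees with Lebesgue measure on intervals. *)
Lemma incr_substitution_set phi dphi (a b : R) (B : set R) : a < b ->
  {in `[a, b] &, {mono phi : x y / x <= y}} ->
  (forall x, x \in `[a, b] -> is_derive x 1 phi (dphi x)) ->
  (forall x, x \in `[a, b] -> {for x, continuous dphi}) ->
  measurable B ->
  mu (B `&` phi @` `]a, b]) =
  (\int[mu]_(x in `]a, b]%classic `&` phi @^-1` B) `|dphi x|%:E)%E.
Proof.
move=> ab mphi dphiE cdphi mB.
have cphi x : x \in `[a, b] -> {for x, continuous phi}.
  move=> xab; apply/differentiable_continuous/derivable1_diffP.
  by have [] := dphiE x xab.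
have wcphi : {within `[a, b], continuous phi}.
  by apply: continuous_in_subspaceT => x; rewrite inE; exact: cphi.
have wcdphi : {within `[a, b], continuous dphi}.
  by apply: continuous_in_subspaceT => x; rewrite inE; exact: cdphi.
have ainab : a \in `[a, b] by rewrite in_itv/= lexx ltW.
have binab : b \in `[a, b] by rewrite in_itv/= lexx ltW.
have sub : `]a, b]%classic `<=` `[a, b]%classic by exact: subset_itv_oc_cc.
have sphi : {in `[a, b] &, {mono phi : x y / x < y}} by exact: leW_mono_in.
have mp : measurable_fun `]a, b]%classic phi.
  by apply: measurable_funS sub _ => //; exact: subspace_continuous_measurable_fun.
have mg : measurable_fun `]a, b]%classic (fun x => `|dphi x|%:E).
  apply/measurable_EFinP; apply: measurableT_comp => //.
  by apply: measurable_funS sub _ => //; exact: subspace_continuous_measurable_fun.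
have ge0g x : `]a, b]%classic x -> (0 <= `|dphi x|%:E)%E by rewrite lee_fin.
have [nu nuE] := @density_pushforward _ _ (measurableTypeR R)
  (measurableTypeR R) R mu _ phi _ (measurable_itv _) mp mg ge0g.
have pab : phi a < phi b by rewrite sphi.
have imphi : phi @` `]a, b] = `]phi a, phi b]%classic.
  apply/seteqP; split => [_ [x /= + <-]|y /=].
    rewrite in_itv/= => /andP[ax xb].
    have xab : x \in `[a, b] by rewrite in_itv/= (ltW ax).
    by rewrite in_itv/= sphi// ax mphi.
  rewrite in_itv/= => /andP[ay yb].
  have [|x xab xy] := @IVT R phi a b y (ltW ab) wcphi.
    by rewrite minEle maxEle (ltW pab) (ltW ay).
  exists x => //=; move: ay yb; rewrite -xy sphi// => ax _.
  by move: xab; rewrite !in_itv/= ax => /andP[].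
have mC : measurable (~` (`]phi a, phi b]%classic : set (measurableTypeR R))).
  exact: measurableC.
pose rest := mrestr mu mC.
pose lam : {measure set (measurableTypeR R) -> \bar R} := measure_add nu rest.
have lamD A : lam A = (nu A + rest A)%E by exact: measure_addE.
have FTC x y : x \in `[a, b] -> y \in `[a, b] -> x <= y ->
    (\int[mu]_(x in `]x, y]) `|dphi x|%:E = (phi y - phi x)%:E)%E.
  move=> xab yab; rewrite le_eqVlt => /predU1P[->|xy].
    by rewrite set_itvoc0 integral_set0 subrr.
  have xysub : {subset `[x, y] <= `[a, b]}.
    move=> z; move: xab yab; rewrite !in_itv/= => /andP[ax _] /andP[_ yb].
    by move=> /andP[xz zy]; rewrite (le_trans ax xz) (le_trans zy yb).
  have wcxy : {within `[x, y], continuous dphi}.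
    by apply: continuous_subspaceW wcdphi => z/=; exact: xysub.
  have mdphi : measurable_fun `]x, y[%classic dphi.
    apply: (@measurable_funS _ _ _ _ `[x, y]%classic) => //.
      exact: subset_itv_oo_cc.
    exact: subspace_continuous_measurable_fun.
  rewrite integral_itv_bndoo; last first.
    by apply/measurable_EFinP; exact: measurableT_comp.
  have dge0 z : z \in `]x, y[ -> 0 <= dphi z.
    move=> zxy; have zab : z \in `[a, b].
      by apply/xysub; exact: subset_itv_oo_cc zxy.
    have [dz <-] := dphiE z zab; rewrite -derive1E.
    apply: (@incr_derive1_ge0_itv _ _ true false x y); last exact: zxy.
      move=> w /set_mem/= wxy.
      have /dphiE[] // : w \in `[a, b].
      by apply: xysub; exact: subset_itv_oo_cc wxy.
    by move=> u w /xysub uab /xysub wab; rewrite sphi.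
  under eq_integral => z /set_mem/= zxy do rewrite ger0_norm ?dge0//.
  rewrite -(@integral_itv_bndoo _ _ _ _ true false); last exact/measurable_EFinP.
  rewrite (@continuous_FTC2 _ dphi phi)//.
  - split.
    + move=> z zxy; have /dphiE[] // : z \in `[a, b].
      by apply: xysub; exact: subset_itv_oo_cc zxy.
    + by apply: cvg_at_right_filter; exact: cphi.
    + by apply: cvg_at_left_filter; exact: cphi.
  - move=> z zxy; rewrite derive1E.
    by have /dphiE[_ ->] : z \in `[a, b]
      by apply: xysub; exact: subset_itv_oo_cc zxy.
(* The endpoints of a test interval need not be values of [phi]. Moving them into the segment from
   [phi a] to [phi b] gives them preimages, and comparisons with [phi s] are unaffected as long as
   [s > a]; the exclusion of [a] is essential here. *)
pose clamp t := Num.max (phi a) (Num.min t (phi b)).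
have clampP t : exists2 x, x \in `[a, b] & phi x = clamp t.
  apply: IVT (ltW ab) wcphi _; rewrite minEle maxEle (ltW pab) /clamp.
  by rewrite le_max lexx/= ge_max (ltW pab) ge_min lexx orbT.
have clampl t s : s \in `]a, b] -> (t < phi s) = (clamp t < phi s).
  rewrite in_itv/= => /andP[as_ sb].
  have sab : s \in `[a, b] by rewrite in_itv/= (ltW as_).
  rewrite /clamp gt_max sphi// as_/= gt_min.
  by rewrite [phi b < phi s]ltNge mphi// sb orbF.
have lamE X : ocitv X -> mu X = lam X.
  move=> [[p q] _ <-]; rewrite lamD nuE /rest /= /mrestr.
  have [x xab xE] := clampP p; have [y yab yE] := clampP q.
  have E : `]a, b]%classic `&` phi @^-1` `]p, q] = `]x, y]%classic.
    apply/seteqP; split => [s [/= sab]|s /=]; rewrite !in_itv/=.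
      rewrite (clampl p)// leNgt (clampl q)// -leNgt -xE -yE.
      have sab' : s \in `[a, b] by exact: subset_itv_oc_cc sab.
      by rewrite sphi// mphi.
    move=> /andP[xs sy]; move: (xab) (yab); rewrite !in_itv/=.
    move=> /andP[ax _] /andP[_ yb].
    have sab : s \in `]a, b] by rewrite in_itv/= (le_lt_trans ax xs) (le_trans sy yb).
    have sab' : s \in `[a, b] by exact: subset_itv_oc_cc sab.
    split; first by move: sab; rewrite in_itv.
    rewrite (clampl p)// leNgt (clampl q)// -leNgt -xE -yE.
    by rewrite sphi// mphi// xs.
  have Q : `]p, q]%classic `&` `]phi a, phi b]%classic = `]phi x, phi y]%classic.
    rewrite -imphi; apply/seteqP; split => [z [+ [s sab zs]]|z zxy].
      rewrite -zs => pqs.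
      have : `]x, y]%classic s by rewrite -E.
      rewrite /= !in_itv/= => /andP[xs sy].
      have sab' : s \in `[a, b] by exact: subset_itv_oc_cc sab.
      by rewrite sphi// mphi// xs.
    have [s sab sz] : (phi @` `]a, b]) z.
      rewrite imphi; move: zxy; rewrite /= !in_itv/= => /andP[xz zy].
      move: (xab) (yab); rewrite !in_itv/= => /andP[ax _] /andP[_ yb].
      have ainab' : phi a <= phi x by rewrite mphi.
      have : phi y <= phi b by rewrite mphi.
      by move=> yb'; rewrite (le_lt_trans ainab' xz) (le_trans zy yb').
    have sab' : s \in `[a, b] by exact: subset_itv_oc_cc sab.
    have : `]x, y]%classic s.
      by move: zxy; rewrite -sz /= !in_itv/= sphi// mphi.
    by rewrite -E -sz => -[_ pq]; split => //; exists s.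
  rewrite E -[in LHS](setIT `]p, q]%classic) -(setUv `]phi a, phi b]%classic).
  rewrite setIUr measureU//; first last.
  - by rewrite setIACA setICr setI0.
  - exact: measurableI.
  - exact: measurableI.
  rewrite Q; congr (_ + _)%E.
  rewrite -[LHS]/(mu `]phi x, phi y]%classic) lebesgue_measure_itv/= lte_fin.
  have [yx|xy] := leP y x.
    rewrite set_itv_ge ?integral_set0 -?leNgt ?bnd_simp//.
    by rewrite ltNge mphi// yx.
  by rewrite FTC ?(ltW xy)// sphi// xy EFinB.
(* Lebesgue measure thus equals [lam] on measurable sets; inside the image of [phi] the summand
   [rest] vanishes. *)
have muE := @lebesgue_measure_unique R lam lamE.
rewrite muE; last by rewrite imphi; apply: measurableI.
rewrite lamD nuE /rest/= /mrestr.
rewrite imphi -setIA setICr setI0 measure0 adde0.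
congr (integral _ _ _).
rewrite -imphi preimage_setI setIA; apply/setIidl => x [/= xab _].
by exists x.
Qed.

(** By injectivity the image is that of the closed segment, again a segment, without the one point
    [phi a]. *)
Lemma measurable_image_itvoc phi (a b : R) : a < b ->
  {within `[a, b], continuous phi} -> {in `[a, b] &, injective phi} ->
  measurable (phi @` `]a, b]).
Proof.
move=> ab cphi phiI.
have -> : phi @` `]a, b] = phi @` `[a, b] `\ phi a.
  apply/seteqP; split => [_ [x /= xab <-]|_ [[x /= xab <-] xa]].
    have xab' : x \in `[a, b] by exact: subset_itv_oc_cc xab.
    split; first by exists x.
    move=> /phiI-/(_ xab'); rewrite in_itv/= lexx ltW// => /(_ isT) xa.
    by move: xab; rewrite xa in_itv/= ltxx.
  exists x => //=; move: xab; rewrite !in_itv/= le_eqVlt => /andP[/predU1P[ax|->]]//.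
  by rewrite ax in xa.
by rewrite continuous_inj_image_segment// ?ltW//; exact: measurableD.
Qed.

(** A continuous injection on a segment is monotone. The decreasing case is the increasing one for
    [- phi] and the reflected set, since Lebesgue measure is invariant under reflection. *)
Lemma inj_substitution_set phi dphi (a b : R) (B : set R) : a < b ->
  {in `[a, b] &, injective phi} ->
  (forall x, x \in `[a, b] -> is_derive x 1 phi (dphi x)) ->
  (forall x, x \in `[a, b] -> {for x, continuous dphi}) ->
  measurable B ->
  mu (B `&` phi @` `]a, b]) =
  (\int[mu]_(x in `]a, b]%classic `&` phi @^-1` B) `|dphi x|%:E)%E.
Proof.
move=> ab phiI dphiE cdphi mB.
have cphi x : x \in `[a, b] -> {for x, continuous phi}.
  move=> xab; apply/differentiable_continuous/derivable1_diffP.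
  by have [] := dphiE x xab.
have wcphi : {within `[a, b], continuous phi}.
  by apply: continuous_in_subspaceT => x; rewrite inE; exact: cphi.
have [incr|decr] := itv_continuous_inj_mono wcphi phiI.
  apply: incr_substitution_set => //.
  by apply: le_mono_in.
have mBN : measurable (-%R @^-1` B).
  by rewrite -[X in measurable X]setTI; exact: oppr_measurable.
have BE : -%R @^-1` B `&` (- phi) @` `]a, b] = -%R @^-1` (B `&` phi @` `]a, b]).
  apply/seteqP; split => [y [/= By [x xab xy]]|y /= [By [x xab xy]]].
    by split => //; exists x => //; rewrite -xy fctE opprK.
  by split => //; exists x => //; rewrite fctE xy opprK.
transitivity (mu (-%R @^-1` B `&` (- phi) @` `]a, b])).
  rewrite BE -[LHS]lebesgue_measureN//.
  by apply: measurableI => //; exact: measurable_image_itvoc.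
have phiN : {in `[a, b] &, {mono (- phi) : x y / x <= y}}.
  by move=> x y xab yab; rewrite !fctE lerN2; exact: (le_nmono_in decr).
have dphiN x : x \in `[a, b] -> is_derive x 1 (- phi) ((- dphi) x).
  by move=> xab; apply: is_deriveN; exact: dphiE.
have cdphiN x : x \in `[a, b] -> {for x, continuous (- dphi)}.
  by move=> xab; apply: cvgN; exact: cdphi.
rewrite (incr_substitution_set _ _ _ _ _ ab phiN dphiN cdphiN mBN).
under eq_integral => x _ do rewrite normrN.
congr (integral _ _ _); congr (_ `&` _).
by apply/seteqP; split => x /=; rewrite fctE opprK.
Qed.

(** The intervals are those with rational endpoints whose closure lies in [U], so that the
    hypotheses of the substitution hold at the endpoints too. Indices that encode no such interval
    give the empty set. *)
Lemma open_bigcup_itvoc (U : set R) : open U ->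
  exists2 F : nat -> set R, U = \bigcup_n F n &
    forall n, F n = set0 \/
      exists a b, [/\ a < b, `[a, b]%classic `<=` U & F n = `]a, b]%classic].
Proof.
move=> oU.
pose P (pq : rat * rat) := `[< `[ratr pq.1, ratr pq.2 : R]%classic `<=` U >] &&
  (ratr pq.1 < ratr pq.2 :> R).
pose G (pq : rat * rat) : set R :=
  if P pq then `]ratr pq.1, ratr pq.2]%classic else set0.
exists (fun n => if unpickle n is Some pq then G pq else set0).
  apply/seteqP; split => [x Ux|x [n _]]; last first.
    case: unpickle => [pq|//]; rewrite /G; case: ifPn => // /andP[/asboolP + _].
    by move=> sub xpq; apply: sub; exact: subset_itv_oc_cc xpq.
  have /nbhs_ballP[e /= e0 xeU] : nbhs x U by exact: open_nbhs_nbhs.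
  have [p /andP[xp px]] : exists p : rat, x - e < (ratr p : R) < x.
    have [|p] := @rat_in_itvoo R (x - e) x; first by rewrite ltrBlDr ltrDl.
    by rewrite in_itv; exists p.
  have [q /andP[xq qx]] : exists p : rat, x < (ratr p : R) < x + e.
    have [|q] := @rat_in_itvoo R x (x + e); first by rewrite ltrDl.
    by rewrite in_itv; exists q.
  have Ppq : P (p, q).
    apply/andP; split; last exact: lt_trans px xq.
    apply/asboolP => y /=; rewrite in_itv/= => /andP[py yq]; apply: xeU.
    by rewrite /ball/= ltr_distlC (lt_le_trans xp py) (le_lt_trans yq qx).
  exists (pickle (p, q)); first exact: Logic.I.
  rewrite pickleK /G Ppq set_itvE; apply/andP; split; first exact: px.
  exact: ltW.
move=> n; case: unpickle => [pq|]; last by left.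
rewrite /G; case: ifPn => [/andP[/asboolP sub lt]|_]; last by left.
by right; exists (ratr pq.1), (ratr pq.2).
Qed.

(** The intervals covering [U] overlap, so they are first made disjoint. A piece [E n] is then only
    a measurable subset of one interval, and the formula on that interval is applied to the part of
    [B] in the image of [E n]. *)
Lemma open_substitution_set phi dphi (U B : set R) : open U ->
  {in U &, injective phi} ->
  (forall x, U x -> is_derive x 1 phi (dphi x)) ->
  (forall x, U x -> {for x, continuous dphi}) ->
  measurable B ->
  measurable (phi @` U) /\
  mu (B `&` phi @` U) =
  (\int[mu]_(x in U `&` phi @^-1` B) `|dphi x|%:E)%E.
Proof.
move=> oU phiI dphiE cdphi mB.
have cphi x : U x -> {for x, continuous phi}.
  move=> xab; apply/differentiable_continuous/derivable1_diffP.
  by have [] := dphiE x xab.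
have mU : measurable U by exact: open_measurable.
have mphi : measurable_fun U phi.
  by apply: open_continuous_measurable_fun => // x; rewrite inE; exact: cphi.
have mdphi : measurable_fun U (fun x => `|dphi x|%:E).
  apply/measurable_EFinP; apply: measurableT_comp => //.
  by apply: open_continuous_measurable_fun => // x; rewrite inE; exact: cdphi.
have [F UF FE] := open_bigcup_itvoc U oU.
have FU n : F n `<=` U by rewrite UF; exact: bigcup_sup.
have mF n : measurable (F n).
  by have [->|[a [b [_ _ ->]]]] := FE n.
have mphiF n : measurable (phi @` F n).
  have [->|[a [b [ab abU ->]]]] := FE n; first by rewrite image_set0.
  apply: measurable_image_itvoc => //.
    apply: continuous_in_subspaceT => x; rewrite inE => /abU; exact: cphi.
  by move=> x y /abU Ux /abU Uy; apply: phiI; rewrite inE.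
pose E := seqDU F.
have EF n : E n `<=` F n by exact: subset_seqDU.
have EU n : E n `<=` U by exact: subset_trans (FU n).
have mE n : measurable (E n) by exact: seqDU_measurable.
have UE : U = \bigcup_n E n by rewrite UF seqDU_bigcup_eq.
(* Injectivity turns the image of a difference into the difference of the images; hence the images
   of the pieces are measurable. *)
have phiE n : phi @` E n = phi @` F n `\` \bigcup_(j < n) (phi @` F j).
  apply/seteqP; split => [_ [x [Fx nFx] <-]|_ [[x Fx <-] nphi]].
    split; first by exists x.
    move=> [j /= jn [y Fy yx]]; apply: nFx.
    rewrite -bigcup_mkord; exists j => //=.
    by rewrite -(phiI y x) ?inE//; [exact: FU Fy|exact: FU Fx].
  exists x => //; split => //; rewrite -bigcup_mkord => -[j /= jn Fjx].
  by apply: nphi; exists j => //; exists x.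
have mphiE n : measurable (phi @` E n).
  by rewrite phiE; apply: measurableD => //; exact: bigcup_measurable.
have phiUE : phi @` U = \bigcup_n (phi @` E n) by rewrite UE image_bigcup.
split; first by rewrite phiUE; exact: bigcupT_measurable.
have tE : trivIset setT E by exact: trivIset_seqDU.
rewrite phiUE setI_bigcupr.
rewrite measure_semi_bigcup//; last 3 first.
- by move=> n; apply: measurableI; [exact: mB|exact: mphiE].
- apply/trivIsetP => i j _ _ ij; rewrite -subset0 => _ [[_ [x Ex <-]] [_ [y Ey yx]]].
  move/trivIsetP : tE => /(_ i j Logic.I Logic.I ij); rewrite -subset0.
  move=> /(_ x) E0; apply: E0; split; first exact: Ex.
  by rewrite -(phiI y x) ?inE//; [exact: EU Ey|exact: EU Ex].
- by apply: bigcupT_measurable => n; apply: measurableI; [exact: mB|exact: mphiE].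
rewrite [in RHS]UE setI_bigcupl ge0_integral_bigcup//; last 3 first.
- by move=> n; rewrite -(setIidl (EU n)) -setIA; exact: (measurableI _ _ (mE n) (mphi mU B mB)).
- apply: measurable_funS mdphi => //.
  by apply: bigcup_sub => n _ x [/EU].
- exact: trivIset_setIr.
apply: eq_eseriesr => n _.
have [F0|[a [b [ab abU Fab]]]] := FE n.
  have -> : E n = set0 by apply/seteqP; split => // x /EF; rewrite F0.
  by rewrite image_set0 setI0 set0I measure0 integral_set0.
have {1}-> : phi @` E n = phi @` E n `&` phi @` `]a, b].
  by apply/esym/setIidl; apply: image_subset; rewrite -Fab.
have abI : {in `[a, b] &, injective phi}.
  by move=> x y /abU Ux /abU Uy; apply: phiI; rewrite inE.
have dab x : x \in `[a, b] -> is_derive x 1 phi (dphi x).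
  by move=> /abU; exact: dphiE.
rewrite setIA; apply: etrans (inj_substitution_set _ _ _ _ _ ab abI dab _ _) _.
- by move=> x /abU; exact: cdphi.
- by apply: measurableI; [exact: mB|exact: mphiE].
congr (integral _ _ _); apply/seteqP; split => x /=.
  move=> [xab [Bx [y Ey yx]]]; split => //.
  rewrite -(phiI y x) ?inE//; first exact: EU Ey.
  by apply: abU; exact: subset_itv_oc_cc xab.
move=> [Ex Bx]; split; last by split => //; exists x.
by have := EF _ _ Ex; rewrite Fab.
Qed.

(** On measurable subsets of the image of [U], the set version identifies Lebesgue measure with the
    image of the measure with density [|dphi|]; then [ge0_integral_density] applies. *)
Lemma ge0_integral_substitution phi dphi (U : set R) (f : R -> \bar R) :
  open U -> {in U &, injective phi} ->
  (forall x, U x -> is_derive x 1 phi (dphi x)) ->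
  (forall x, U x -> {for x, continuous dphi}) ->
  measurable_fun setT f -> (forall y, (0 <= f y)%E) ->
  (\int[mu]_(y in phi @` U) f y = \int[mu]_(x in U) (f (phi x) * `|dphi x|%:E))%E.
Proof.
move=> oU phiI dphiE cdphi mf f0.
have mU : measurable U by exact: open_measurable.
have mphi : measurable_fun U phi.
  apply: open_continuous_measurable_fun => // x; rewrite inE => Ux.
  apply/differentiable_continuous/derivable1_diffP.
  by have [] := dphiE x Ux.
have mdphi : measurable_fun U (fun x => `|dphi x|).
  apply: measurableT_comp => //.
  by apply: open_continuous_measurable_fun => // x; rewrite inE; exact: cdphi.
have subst := open_substitution_set _ _ _ _ oU phiI dphiE cdphi.
have mphiU : measurable (phi @` U) by have [] := subst setT measurableT.
have mg : measurable_fun U (fun x => `|dphi x|%:E) by exact/measurable_EFinP.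
have g0 x : U x -> (0 <= `|dphi x|%:E)%E by rewrite lee_fin.
have [nu nuE] := density_pushforward _ _ (measurableTypeR R)
  (measurableTypeR R) R mu _ phi _ mU mphi mg g0.
transitivity (\int[nu]_(y in phi @` U) f y)%E.
  apply: eq_measure_integral => A mA AU; rewrite nuE -(subst A mA).2.
  by rewrite (setIidl AU).
rewrite (@ge0_integral_density _ _ _ _ _ mu nu U phi (fun x => `|dphi x|))//.
  by congr (integral _ _ _); apply/setIidl => x Ux; exists x.
exact: measurable_funTS.
Qed.

End substitution.

(** * Integrals over star-shaped sets *)

Lemma is_derive_affine {R : realType} (a b x : R) :
  is_derive x 1 (fun y => a + b * y) b.
Proof.
apply: is_derive_eq.
by rewrite add0r mul1r /GRing.scale /= mulr1.
Qed.

Section half_plane.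
Context {R : realType}.
Notation mu := (@lebesgue_measure R).
Variables (v : R * R) (h : R * R -> \bar R) (sg : R).
Hypotheses (mh : measurable_fun [set: R * R] h) (h0 : forall y, (0 <= h y)%E).
Hypothesis sg1 : `|sg| = 1.

Let sgn0 : sg != 0. Proof. by rewrite -normr_gt0 sg1. Qed.

Let ray (p : R * R) : R * R := (v.1 + sg * p.1, v.2 + sg * p.1 * p.2).

Let mray : measurable_fun [set: R * R] ray.
Proof.
apply/measurable_fun_pairP; split.
  by apply: measurable_funD => //; apply: measurable_funM.
apply: measurable_funD => //; apply: measurable_funM => //.
exact: measurable_funM.
Qed.

(* With sg = 1 or -1 choosing the half plane, the new coordinates are the
   distance x to the vertical line through v and the slope m. *)
Lemma half_plane_integral :
  (\int[mu]_(x in [set x : R | (0 < sg * (x - v.1))%R]) (\int[mu]_y h (x, y)) =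
   \int[mu]_m \int[mu]_(x in `]0%R, +oo[)
      (h (v.1 + sg * x, v.2 + sg * x * m)%R * x%:E))%E.
Proof.
have mF : measurable_fun setT (fun x => \int[mu]_y h (x, y))%E.
  exact: measurable_fun_fubini_tonelli_F.
have F0 x : (0 <= \int[mu]_y h (x, y))%E by apply: integral_ge0.
have -> : [set x | 0 < sg * (x - v.1)] = (fun x => v.1 + sg * x) @` `]0, +oo[.
  apply/seteqP; split => [x /= sx|_ [x + <-]]/=.
    exists (sg * (x - v.1)); first by rewrite /= in_itv/= andbT.
    by rewrite mulrA -expr2 -real_normK ?num_real// sg1 expr1n mul1r addrC subrK.
  rewrite /= in_itv/= andbT => x0.
  by rewrite addrAC subrr add0r mulrA -expr2 -real_normK ?num_real// sg1 expr1n mul1r.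
rewrite (ge0_integral_substitution _ (fun=> sg) _ _ _ _
  (fun x _ => is_derive_affine _ _ x))//; last 2 first.
- by move=> x y _ _ /addrI /(mulfI sgn0).
- by move=> x _; exact: cst_continuous.
(* Extending the weight [x] by zero to [x <= 0] gives a nonnegative function on the whole plane, to
   which Tonelli's theorem applies. *)
pose k (z : R * R) : \bar R := (h (ray z) * (Num.max z.1 0)%:E)%E.
have mk : measurable_fun [set: R * R] k.
  apply: emeasurable_funM; first exact: measurableT_comp.
  by apply/measurable_EFinP; apply: measurable_maxr.
have k0 z : (0 <= k z)%E by rewrite mule_ge0// lee_fin le_max lexx orbT.
transitivity (\int[mu]_x \int[mu]_m k (x, m))%E.
  rewrite integral_mkcond; apply: eq_integral => x _; rewrite patchE.
  rewrite mem_setE in_itv/= andbT; case: ltP => x0; last first.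
    by rewrite integral0_eq// => m _; rewrite /k/= (max_idPr x0) mule0.
  rewrite sg1 mule1.
  rewrite -[X in (\int[mu]_(y in X) _)%E = _](_ : (fun m => v.2 + sg * x * m) @` setT = _).
    rewrite (ge0_integral_substitution _ (fun=> sg * x) _ _ _ _
      (fun y _ => is_derive_affine _ _ y))//.
    - apply: eq_integral => m _.
      by rewrite normrM sg1 mul1r gtr0_norm// /k/= (max_idPl (ltW x0)).
    - exact: openT.
    - move=> y z _ _ /addrI /mulfI; apply.
      by rewrite mulf_neq0// lt0r_neq0.
    - by move=> y _; exact: cst_continuous.
    - by apply: measurableT_comp => //; exact: measurable_pair1.
  apply/seteqP; split => // y _; exists ((y - v.2) / (sg * x)) => //.
  have sgx : sg * x != 0 by rewrite mulf_neq0// lt0r_neq0.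
  by rewrite [X in _ + X]mulrC divfK// addrC subrK.
have FT := @fubini_tonelli _ _ _ _ R (@lebesgue_measure R) (@lebesgue_measure R) k mk k0.
apply: (etrans FT); apply: eq_integral => m _.
rewrite [RHS]integral_mkcond; apply: eq_integral => x _; rewrite patchE.
rewrite mem_setE in_itv/= andbT; case: ltP => x0.
  by rewrite /k/= (max_idPl (ltW x0)).
by rewrite /k/= (max_idPr x0) mule0.
Qed.

End half_plane.

Lemma subset1_measure0 {R : realType} (A : set R) : (forall x y, A x -> A y -> x = y) ->
  measurable (A : set (measurableTypeR R)) /\ lebesgue_measure A = 0%E.
Proof.
move=> A1; have [[x Ax]|A0] := pselect (exists x, A x).
  have -> : A = [set x] by apply/seteqP; split => [y Ay|y ->//]; exact: A1.
  by split; [exact: measurable_set1|exact: lebesgue_measure_set1].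
have -> : A = set0 by apply/seteqP; split => // x Ax; apply: A0; exists x.
by split; [exact: measurable0|exact: measure0].
Qed.

Section star_shaped.
Context {R : realType}.
Notation mu := (@lebesgue_measure R).
(** [(c, d)] stands for [gamma - v] and [(dc, dd)] for its derivative. The star enters only through
    the support of [h], so that Tonelli's theorem can be used on the whole plane. *)
Variables (v : R * R) (L : R) (c d dc dd : R -> R) (h : R * R -> \bar R).
Hypotheses (mh : measurable_fun [set: R * R] h) (h0 : forall y, (0 <= h y)%E).
Hypothesis hsupp : forall y, h y != 0%E -> exists s r,
  [/\ 0 <= s <= L, 0 <= r <= 1 & y = (v.1 + r * c s, v.2 + r * d s)].
Hypothesis dirI : forall s t k, 0 <= s <= L -> 0 <= t <= L -> 0 < k ->
  c t = k * c s -> d t = k * d s -> s = t.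
Hypothesis cd0 : forall s, 0 < s < L -> c s = 0 -> d s != 0.
Hypothesis dcE : forall s, 0 < s < L -> is_derive s 1 c (dc s).
Hypothesis ddE : forall s, 0 < s < L -> is_derive s 1 d (dd s).
Hypothesis cdc : forall s, 0 < s < L -> {for s, continuous dc}.
Hypothesis cdd : forall s, 0 < s < L -> {for s, continuous dd}.

Let I s := (\int[mu]_(r in `]0%R, 1%R[)
  (h (v.1 + r * c s, v.2 + r * d s)%R * r%:E))%E.

(** Together with the factor [r] in [I], this is the absolute Jacobian determinant of the map from
    [(r, s)] to the plane. *)
Let J s := `|c s * dd s - d s * dc s|.

Lemma measurable_radial (a b : R) : measurable_fun setT
  (fun r : R => (h (v.1 + r * a, v.2 + r * b)%R * r%:E)%E).
Proof.
apply: emeasurable_funM; last exact/measurable_EFinP.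
apply: measurableT_comp => //; apply/measurable_fun_pairP; split.
  by apply: measurable_funD => //; apply: measurable_funM.
by apply: measurable_funD => //; apply: measurable_funM.
Qed.

Let continuousc s : 0 < s < L -> {for s, continuous c}.
Proof.
by move=> /dcE[? _]; apply/differentiable_continuous/derivable1_diffP.
Qed.

Let continuousd s : 0 < s < L -> {for s, continuous d}.
Proof.
by move=> /ddE[? _]; apply/differentiable_continuous/derivable1_diffP.
Qed.

(** [I] is an inner integral of Tonelli's theorem for the function [K] of [(s, r)]. There [c] and
    [d] are replaced by zero off the open interval, since their regularity is only known inside
    it. *)
Lemma measurable_radial_integral : measurable_fun `]0, L[%classic I.
Proof.
have mI : measurable (`]0, L[%classic : set R) by [].
have mc : measurable_fun setT (c \_ `]0, L[).
  apply: (measurable_restrictT _ mI).1.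
  apply: open_continuous_measurable_fun; first exact: itv_open.
  move=> s; rewrite inE/= in_itv/= => s0L.
  exact: continuousc.
have md : measurable_fun setT (d \_ `]0, L[).
  apply: (measurable_restrictT _ mI).1.
  apply: open_continuous_measurable_fun; first exact: itv_open.
  move=> s; rewrite inE/= in_itv/= => s0L.
  exact: continuousd.
pose K (z : R * R) : \bar R :=
  (h (v.1 + z.2 * (c \_ `]0, L[) z.1, v.2 + z.2 * (d \_ `]0, L[) z.1)%R *
   (\1_`]0, 1[ z.2 * Num.max z.2 0)%:E)%E.
have mK : measurable_fun setT K.
  apply: emeasurable_funM.
    apply: measurableT_comp => //; apply/measurable_fun_pairP; split.
      apply: measurable_funD => //; apply: measurable_funM => //.
      exact: (measurableT_comp mc).
    apply: measurable_funD => //; apply: measurable_funM => //.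
    exact: (measurableT_comp md).
  apply/measurable_EFinP; apply: measurable_funM; last exact: measurable_maxr.
  by apply: measurableT_comp => //; exact: measurable_indic.
have K0 z : (0 <= K z)%E.
  by rewrite mule_ge0// lee_fin mulr_ge0// le_max lexx orbT.
have mF := @measurable_fun_fubini_tonelli_F _ _ _ _ _ mu K mK K0.
have : measurable_fun `]0, L[%classic (fubini_F mu K) by exact: measurable_funTS.
apply: eq_measurable_fun => s s0L.
rewrite /fubini_F /I [RHS]integral_mkcond; apply: eq_integral => r _.
rewrite /K/= !patchE s0L indicE; case: ifPn => [r01|]; rewrite ?mul0r ?mule0//.
by move: r01; rewrite inE/= in_itv/= => /andP[/ltW r0 _]; rewrite mul1r (max_idPl r0).
Qed.

Section half.
Variable sg : R.
Hypothesis sg1 : `|sg| = 1.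

Let sgn0 : sg != 0. Proof. by rewrite -normr_gt0 sg1. Qed.
Let sg2 : sg * sg = 1.
Proof. by rewrite -expr2 -real_normK ?num_real// sg1 expr1n. Qed.

Let H m := (\int[mu]_(x in `]0%R, +oo[)
  (h (v.1 + sg * x, v.2 + sg * x * m)%R * x%:E))%E.

Let support m x : 0 < x -> h (v.1 + sg * x, v.2 + sg * x * m) != 0%E ->
  exists s r, [/\ 0 <= s <= L, 0 < r <= 1, sg * x = r * c s & sg * x * m = r * d s].
Proof.
move=> x0 /hsupp[s [r [sL /andP[r0 r1] [/addrI E1 /addrI E2]]]].
exists s, r; split => //; rewrite r1 andbT lt0r r0 andbT.
apply/eqP => r00; move: E1; rewrite r00 mul0r => /eqP.
by rewrite mulf_eq0 (negbTE sgn0) (gt_eqF x0).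
Qed.

(** On this ray [x = a * r] with [a = |c s|]. Beyond [x = a] the function [h] vanishes: a point of
    the star there would belong to a parameter [t] with the same direction, hence [t = s], and then
    [r <= 1] forces [x <= a]. The weight [x] and the differential each contribute a factor [a],
    whence [c s ^+ 2]. *)
Lemma ray_integral s : 0 < s < L -> 0 < sg * c s ->
  H (d s / c s) = (I s * (c s ^+ 2)%:E)%E.
Proof.
move=> /andP[s0 sL] a0; set a := sg * c s in a0.
have cE : c s = sg * a by rewrite /a mulrA sg2 mul1r.
have cs0 : c s != 0 by rewrite cE mulf_neq0// lt0r_neq0.
set m := d s / c s.
have dE : d s = m * c s by rewrite /m divfK.
pose g x := (h (v.1 + sg * x, v.2 + sg * x * m)%R * (Num.max x 0)%:E)%E.
have mg : measurable_fun setT g.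
  apply: emeasurable_funM; last first.
    by apply/measurable_EFinP; exact: measurable_maxr.
  apply: measurableT_comp => //; apply/measurable_fun_pairP; split.
    by apply: measurable_funD => //; apply: measurable_funM.
  by apply: measurable_funD => //; do 2?apply: measurable_funM => //.
have g0 x : (0 <= g x)%E by rewrite mule_ge0// lee_fin le_max lexx orbT.
have hz x : a < x -> h (v.1 + sg * x, v.2 + sg * x * m) = 0%E.
  move=> ax; apply/eqP/negP => /negP.
  have x0 : 0 < x := lt_trans a0 ax.
  move=> /(support _ _ x0)[t [r [tL /andP[r0 r1] E1 E2]]].
  have rn0 : r != 0 by rewrite lt0r_neq0.
  have st : s = t.
    apply: (@dirI s t (x / (r * a))) => //.
    - by rewrite !ltW.
    - by rewrite divr_gt0// mulr_gt0.
    - apply: (mulfI rn0); rewrite -E1 cE.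
      by field; rewrite rn0 lt0r_neq0.
    - apply: (mulfI rn0); rewrite -E2 dE cE.
      by field; rewrite rn0 lt0r_neq0.
  move: E1; rewrite -st cE => /(congr1 (fun z => sg * z)).
  rewrite mulrA sg2 mul1r mulrCA [sg * (sg * a)]mulrA sg2 mul1r => xE.
  by move: ax; rewrite xE ltNge ler_piMl// ltW.
transitivity (\int[mu]_(x in `]0%R, a[) g x)%E.
  (* The endpoint [a] is added first, because [h] is known to vanish only strictly beyond it. *)
  rewrite -(@integral_itv_bndoo _ _ _ _ false false); last exact: measurable_funTS.
  rewrite /H integral_mkcond [RHS]integral_mkcond; apply: eq_integral => x _.
  rewrite !patchE !mem_setE !in_itv/= andbT; case: ltP => //= x0.
  by case: leP => [xa|/hz hz0]; rewrite /g ?(max_idPl (ltW x0))// hz0 mul0e.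
have -> : `]0%R, a[%classic = (fun r => 0 + a * r) @` `]0, 1[.
  apply/seteqP; split => [x|_ [r + <-]].
    rewrite /= in_itv/= => /andP[x0 xa]; exists (x / a).
      by rewrite /= in_itv/= divr_gt0//= ltr_pdivrMr// mul1r.
    by rewrite add0r mulrC divfK// lt0r_neq0.
  rewrite /= !in_itv/= add0r => /andP[r0 r1].
  by rewrite mulr_gt0//= gtr_pMr.
rewrite (ge0_integral_substitution _ (fun=> a) _ _ _ _
  (fun x _ => is_derive_affine _ _ x))//; last 2 first.
- by move=> x y _ _ /addrI /mulfI; apply; rewrite lt0r_neq0.
- by move=> x _; exact: cst_continuous.
rewrite /I -ge0_integralZr//.
- apply: eq_integral => r; rewrite inE/= in_itv/= => /andP[r0 r1].
  have ra : 0 <= a * r by rewrite mulr_ge0// ltW.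
  rewrite /g add0r (max_idPl ra) -!muleA -!EFinM dE.
  rewrite (_ : sg * (a * r) = r * c s); last by rewrite cE mulrA mulrC.
  rewrite (_ : r * c s * m = r * (m * c s)); last by ring.
  congr (_ * _%:E)%E; rewrite gtr0_norm// cE.
  rewrite exprMn [sg ^+ 2]expr2 sg2 mul1r; ring.
- by apply: measurable_funTS; exact: measurable_radial.
- move=> r /=; rewrite in_itv/= => /andP[r0 _].
  by rewrite mule_ge0// lee_fin ltW.
- by rewrite lee_fin sqr_ge0.
Qed.

Let U := [set s | 0 < s < L /\ 0 < sg * c s].

Let openU : open U.
Proof.
have -> : U = `]0, L[%classic `&` [set s | 0 < sg * c s].
  by apply/seteqP; split => s /=; rewrite in_itv.
rewrite openE => s [s0L cs]; rewrite /interior; apply: filterI.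
  by apply: open_nbhs_nbhs; split => //; exact: itv_open.
have sgc : {for s, continuous (fun s => sg * c s)}.
  by apply: cvgM; [exact: cvg_cst|apply: continuousc; move: s0L; rewrite /= in_itv].
exact: (cvgr_gt _ sgc _ cs).
Qed.

(** Substitute the slope [m = d s / c s], injective on [U] by [dirI]. Its derivative is the cross
    product divided by [c s ^+ 2], and this square cancels the one from [ray_integral]. *)
Lemma half_star_integral :
  (\int[mu]_(x in [set x : R | (0 < sg * (x - v.1))%R]) (\int[mu]_y h (x, y)) =
   \int[mu]_(s in U) (I s * (J s)%:E))%E.
Proof.
rewrite half_plane_integral// -/H.
pose slope s := d s / c s.
have cU s : U s -> c s != 0.
  by move=> [_ cs]; apply/eqP => cs0; move: cs; rewrite cs0 mulr0 ltxx.
have slopeI : {in U &, injective slope}.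
  move=> s t /set_mem Us /set_mem Ut st.
  have [Us0 cs] := Us; have [Ut0 ct] := Ut.
  apply: (@dirI s t (c t / c s)).
  - by move/andP : Us0 => [/ltW -> /ltW ->].
  - by move/andP : Ut0 => [/ltW -> /ltW ->].
  - have -> : c t / c s = (sg * c t) / (sg * c s).
      by field; rewrite (cU _ Us).
    by rewrite divr_gt0.
  - by rewrite divfK// cU.
  - move: st; rewrite /slope => /(congr1 (fun z => z * c t)).
    by rewrite divfK ?cU// => <-; field; rewrite cU.
pose dslope s := (c s * dd s - d s * dc s) / c s ^+ 2.
have dslopeE s : U s -> is_derive s 1 slope (dslope s).
  move=> Us; have Us0 := Us.1; have Dc := dcE _ Us0; have Dd := ddE _ Us0.
  have cs0 := cU _ Us.
  have DV : is_derive s 1 (fun s => (c s)^-1) (- (c s) ^- 2 * dc s).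
    case: Dc => Dc <-; apply: DeriveDef; first exact: derivableV.
    by rewrite deriveV.
  apply: is_derive_eq.
  by rewrite /dslope /GRing.scale/=; field.
have cdslope s : U s -> {for s, continuous dslope}.
  move=> Us; have Us0 := Us.1; have cs0 := cU _ Us.
  have cd := continuousc _ Us0.
  apply: cvgM; last first.
    by apply: cvgV; [rewrite expf_neq0|apply: cvgM].
  have cdd' := continuousd _ Us0.
  by apply: cvgB; apply: cvgM => //; [exact: cdd|exact: cdc].
have mH : measurable_fun setT H.
  pose K (z : R * R) : \bar R :=
    (h (v.1 + sg * z.2, v.2 + sg * z.2 * z.1)%R * (Num.max z.2 0)%:E)%E.
  have mK : measurable_fun setT K.
    apply: emeasurable_funM; last by apply/measurable_EFinP; exact: measurable_maxr.
    apply: measurableT_comp => //; apply/measurable_fun_pairP; split.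
      by apply: measurable_funD => //; apply: measurable_funM.
    by apply: measurable_funD => //; do 2?apply: measurable_funM => //.
  have K0 z : (0 <= K z)%E by rewrite mule_ge0// lee_fin le_max lexx orbT.
  have := @measurable_fun_fubini_tonelli_F _ _ _ _ _ mu K mK K0.
  apply: eq_measurable_fun => m _.
  rewrite /fubini_F /H [RHS]integral_mkcond; apply: eq_integral => x _.
  rewrite !patchE mem_setE in_itv/= andbT /K/=.
  by case: ltP => x0 //; rewrite mule0.
have H0 m : (0 <= H m)%E.
  apply: integral_ge0 => x; rewrite /= in_itv/= andbT => x0.
  by rewrite mule_ge0// lee_fin ltW.
transitivity (\int[mu]_(m in slope @` U) H m)%E.
  have : measurable (slope @` U).
    by have [] := open_substitution_set _ _ _ setT openU slopeI dslopeE cdslope measurableT.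
  move=> mU.
  (* The support may contain the rays of the parameters [0] and [L], which [U] leaves out. Their
     slopes form a null set, which is removed from both integrals. *)
  pose N : set (measurableTypeR R) := [set slope 0] `|` [set slope L].
  have mN : measurable N by exact: measurableU.
  have N0 : mu N = 0%E.
    have set1 x : mu [set x] = 0%E by exact: lebesgue_measure_set1.
    by apply: etrans (set1 (slope 0)); apply: measureU0 => //; exact: set1.
  rewrite (ge0_negligible_integral mN measurableT mH (fun x _ => H0 x) N0).
  have mHU : measurable_fun (slope @` U) H by exact: measurable_funTS.
  rewrite [RHS](ge0_negligible_integral mN mU mHU (fun x _ => H0 x) N0).
  rewrite integral_mkcond [RHS]integral_mkcond; apply: eq_integral => m _.
  rewrite !patchE; case: ifPn => [/set_mem[_ mN']|].
    case: ifPn => // mU'.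
    (* For any other slope outside the image of [U] the integrand vanishes: a point of the support
       would give a parameter in [U] with this slope. *)
    rewrite /H integral0_eq// => x; rewrite /= in_itv/= andbT => x0.
    apply/eqP; rewrite mule_eq0; apply/orP; left; apply/negP => /negP.
    move=> /(support _ _ x0)[t [r [/andP[t0 tL] /andP[r0 r1] E1 E2]]].
    have rn0 : r != 0 by rewrite lt0r_neq0.
    have sct : 0 < sg * c t.
      by rewrite -(pmulr_rgt0 _ r0) mulrCA -E1 mulrA sg2 mul1r.
    have ct0 : c t != 0 by apply/eqP => ct0; move: sct; rewrite ct0 mulr0 ltxx.
    have mE : m = slope t.
      rewrite /slope; apply: (mulfI ct0); rewrite [RHS]mulrC divfK//.
      by apply: (mulfI rn0); rewrite mulrA -E1 E2.
    move: t0; rewrite le_eqVlt => /predU1P[t0|t0].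
      by apply: mN'; left; rewrite mE -t0.
    move: tL; rewrite le_eqVlt => /predU1P[tL|tL].
      by apply: mN'; right; rewrite mE tL.
    move: mU'; rewrite notin_setE; apply; split; last exact: mN'.
    by exists t => //; split => //; rewrite t0.
  rewrite notin_setE => mN'; case: ifPn => // /set_mem[_ Nm].
  by exfalso; apply: mN'.
rewrite (ge0_integral_substitution _ dslope)//.
apply: eq_integral => s /set_mem Us; have [s0L cs] := Us.
rewrite /slope ray_integral// -muleA -EFinM; congr (_ * _%:E)%E.
rewrite /dslope normrM normfV normrX real_normK ?num_real//.
rewrite mulrC divfK// expf_neq0//; exact: cU.
Qed.

End half.

Lemma measurable_star_integrand :
  measurable_fun `]0, L[%classic (fun s => I s * (J s)%:E)%E.
Proof.
have mc : measurable_fun `]0, L[%classic c.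
  apply: open_continuous_measurable_fun; first exact: itv_open.
  by move=> s; rewrite inE/= in_itv/=; exact: continuousc.
have md : measurable_fun `]0, L[%classic d.
  apply: open_continuous_measurable_fun; first exact: itv_open.
  by move=> s; rewrite inE/= in_itv/=; exact: continuousd.
have mdc : measurable_fun `]0, L[%classic dc.
  apply: open_continuous_measurable_fun; first exact: itv_open.
  by move=> s; rewrite inE/= in_itv/=; exact: cdc.
have mdd : measurable_fun `]0, L[%classic dd.
  apply: open_continuous_measurable_fun; first exact: itv_open.
  by move=> s; rewrite inE/= in_itv/=; exact: cdd.
apply: emeasurable_funM; first exact: measurable_radial_integral.
apply/measurable_EFinP; apply: measurableT_comp => //.
by apply: measurable_funB; exact: measurable_funM.
Qed.

(** The vertical line through [v] is a null set, and the two open half planes are treated with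
    [sg = 1] and [sg = -1]. On the parameter side the zeros of [c] have to be removed: by [dirI] at
    most one of them points up and at most one points down. *)
Lemma star_integral : (\int[mu \x mu]_z h z =
  \int[mu]_(s in `]0%R, L[) (I s * (J s)%:E))%E.
Proof.
pose F x := (\int[mu]_y h (x, y))%E.
have mF : measurable_fun setT F by exact: measurable_fun_fubini_tonelli_F.
have F0 x : (0 <= F x)%E by apply: integral_ge0.
have normN1 : `|- 1| = 1 :> R by rewrite normrN normr1.
have I0 s : (0 <= I s)%E.
  apply: integral_ge0 => r; rewrite /= in_itv/= => /andP[r0 _].
  by rewrite mule_ge0// lee_fin ltW.
have mc : measurable_fun `]0, L[%classic c.
  apply: open_continuous_measurable_fun; first exact: itv_open.
  by move=> s; rewrite inE/= in_itv/=; exact: continuousc.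
have mIJ := measurable_star_integrand.
pose D (sg : R) : set (measurableTypeR R) := [set x | 0 < sg * (x - v.1)].
have mD sg : measurable (D sg).
  rewrite -[D sg]setTI -[D sg]/((fun x => sg * (x - v.1)) @^-1` [set x | 0 < x]).
  rewrite -(set_itvoy 0).
  have : measurable_fun [set: measurableTypeR R] (fun x : R => sg * (x - v.1)).
    by apply: measurable_funM => //; exact: measurable_funB.
  by apply.
pose U (sg : R) : set (measurableTypeR R) := [set s | 0 < s < L /\ 0 < sg * c s].
have mU sg : measurable (U sg).
  have -> : U sg = `]0, L[%classic `&` (fun s => sg * c s) @^-1` `]0, +oo[.
    by apply/seteqP; split => s; rewrite /= !in_itv/= andbT.
  have : measurable_fun `]0, L[%classic (fun s => sg * c s) by exact: measurable_funM.
  by apply.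
have D1 : [set: measurableTypeR R] `\` [set v.1] = D 1 `|` D (- 1).
  apply/seteqP; split => [x [_ /= xv]|x [] /=].
  - have : x - v.1 != 0 by rewrite subr_eq0; apply/eqP.
    by rewrite /D/= mul1r mulN1r oppr_gt0 neq_lt => /orP[]; [right|left].
  - by rewrite /D/= mul1r subr_gt0 => vx; split => // xv; move: vx; rewrite xv ltxx.
  - rewrite /D/= mulN1r oppr_gt0 subr_lt0 => vx.
    by split => // xv; move: vx; rewrite xv ltxx.
pose Z1s : set (measurableTypeR R) := [set s | [/\ 0 < s < L, c s = 0 & 0 < d s]].
pose Z2s : set (measurableTypeR R) := [set s | [/\ 0 < s < L, c s = 0 & d s < 0]].
have [mZ1 Z1] : measurable Z1s /\ mu Z1s = 0%E.
  apply: subset1_measure0 => s t [/andP[s0 sL] cs ds] [/andP[t0 tL] ct dt].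
  apply: (@dirI s t (d t / d s)); rewrite ?divr_gt0 ?(ltW s0) ?(ltW sL) ?(ltW t0) ?(ltW tL)//.
    by rewrite cs ct mulr0.
  by rewrite divfK// lt0r_neq0.
have [mZ2 Z2] : measurable Z2s /\ mu Z2s = 0%E.
  apply: subset1_measure0 => s t [/andP[s0 sL] cs ds] [/andP[t0 tL] ct dt].
  apply: (@dirI s t (d t / d s)); rewrite ?(ltW s0) ?(ltW sL) ?(ltW t0) ?(ltW tL)//.
  - by rewrite -mulrNN -invrN divr_gt0 ?oppr_gt0.
  - by rewrite cs ct mulr0.
  - by rewrite divfK// ltr0_neq0.
have mZ : measurable ((Z1s `|` Z2s) : set (measurableTypeR R)) by exact: measurableU.
have Z0 : mu (Z1s `|` Z2s) = 0%E by apply: etrans Z1; apply: measureU0.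
have U1 : `]0, L[%classic `\` (Z1s `|` Z2s) = U 1 `|` U (- 1).
  apply/seteqP; split => [s [s0L nZ]|s [[s0L cs]|[s0L cs]]].
  - have s0L' : 0 < s < L by move: s0L; rewrite /= in_itv.
    have : c s != 0.
      apply/eqP => cs0; apply: nZ; have := cd0 _ s0L' cs0.
      by rewrite neq_lt => /orP[ds|ds]; [right|left].
    rewrite neq_lt => /orP[cs|cs]; [right|left]; split => //.
    + by rewrite mulN1r oppr_gt0.
    + by rewrite mul1r.
  - split; first by rewrite /= in_itv.
    by move=> [[_ cs0 _]|[_ cs0 _]]; move: cs; rewrite cs0 mulr0 ltxx.
  - split; first by rewrite /= in_itv.
    by move=> [[_ cs0 _]|[_ cs0 _]]; move: cs; rewrite cs0 mulr0 ltxx.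
transitivity (\int[mu]_x F x)%E.
  exact: (@fubini_tonelli1 _ _ _ _ R (@lebesgue_measure R) (@lebesgue_measure R) h mh h0).
have mv1 : measurable ([set v.1] : set (measurableTypeR R)) by exact: measurable_set1.
have v1 : mu [set v.1] = 0%E by exact: lebesgue_measure_set1.
rewrite (ge0_negligible_integral mv1 measurableT mF (fun x _ => F0 x) v1) D1.
have IJ0 s : `]0, L[%classic s -> (0 <= I s * (J s)%:E)%E.
  by move=> _; rewrite mule_ge0// lee_fin /J.
rewrite [RHS](ge0_negligible_integral mZ (measurable_itv _) mIJ IJ0 Z0) U1.
rewrite ge0_integral_setU//; last 2 first.
- exact: measurable_funTS.
- apply/disj_setPLR => x /=; rewrite /D/= mul1r mulN1r subr_gt0 oppr_gt0 subr_lt0.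
  by move=> vx /(lt_trans vx); rewrite ltxx.
rewrite [RHS]ge0_integral_setU//; last 3 first.
- apply: measurable_funS mIJ => //; rewrite -U1; exact: subDsetl.
- by move=> x _; rewrite mule_ge0// lee_fin /J.
- apply/disj_setPLR => x /= [_ cs] [_]; rewrite mulN1r oppr_gt0.
  by move: cs; rewrite mul1r => cs /(lt_trans cs); rewrite ltxx.
congr (_ + _)%E; apply: half_star_integral => //.
by rewrite normr1.
Qed.

End star_shaped.

(** * Completed measures *)

Lemma dense_rat_seq (R : realType) : exists q : nat -> R,
  forall x y, x < y -> exists n, x < q n < y.
Proof.
exists (fun n => ratr (odflt 0 (unpickle n))) => x y /rat_in_itvoo[p].
by rewrite in_itv => xpy; exists (pickle p); rewrite pickleK.
Qed.

Section completion.
Context d (T : measurableType d) (R : realType).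
Variable mu : {measure set T -> \bar R}.
Notation outer := (mu^*)%mu.

(** If the outer measure is finite, intersect over [n] the unions of countable covers of total
    measure less than the outer measure plus [1 / (n + 1)]; otherwise the whole space will do. *)
Lemma outer_measurable_hull (X : set T) :
  exists F, [/\ measurable F, X `<=` F & mu F = outer X].
Proof.
have [Xoo|Xfin] := eqVneq (outer X) +oo%E.
  exists setT; split => //; apply/eqP; rewrite Xoo eq_le leey/= -Xoo.
  by rewrite -(measurable_mu_extE mu)//; exact: le_mu_ext.
have outer_fin : outer X \is a fin_num.
  by rewrite ge0_fin_numE ?mu_ext_ge0// ltey.
have cover n : exists A, measurable_cover X A /\
    (\sum_(k <oo) mu (A k) < outer X + (n.+1%:R^-1)%:E)%E.
  have n0 : 0 < n.+1%:R^-1 :> R by rewrite invr_gt0.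
  by have /(_ _ n0)[_ /= [A XA <-] ltA] := lb_ereal_inf_adherent _ outer_fin; exists A.
have [A AP] := choice cover.
pose F := \bigcap_n \bigcup_k A n k.
have mAn n : measurable (\bigcup_k A n k).
  by apply: bigcupT_measurable => k; have [[]] := AP n.
have mF : measurable F by exact: bigcapT_measurable.
have XF : X `<=` F by move=> x Xx n _; have [[_ XA] _] := AP n; exact: XA.
exists F; split => //.
apply/eqP; rewrite eq_le; apply/andP; split; last first.
  by rewrite -(measurable_mu_extE mu)//; exact: le_mu_ext.
apply/lee_addgt0Pr => /= _/posnumP[e]; near \oo => n.
have [_ /ltW leA] := AP n.
apply: (@le_trans _ _ (mu (\bigcup_k A n k))).
  by apply: le_measure; rewrite ?inE//; exact: bigcap_inf.
apply: (@le_trans _ _ (\sum_(k <oo) mu (A n k))%E).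
  apply: measure_sigma_subadditive => // k; by have [[]] := AP n.
apply: (le_trans leA); rewrite leeD2l// lee_fin ltW//.
by near: n; exact: near_infty_natSinv_lt.
Unshelve. all: by end_near. Qed.

Lemma measure0_bigcup (N : nat -> set T) :
  (forall n, measurable (N n)) -> (forall n, mu (N n) = 0%E) ->
  mu (\bigcup_n N n) = 0%E.
Proof.
move=> mN N0; apply/eqP; rewrite eq_le measure_ge0 andbT.
have <- : (\sum_(k <oo) mu (N k) = 0)%E by exact: eseries0.
by apply: measure_sigma_subadditive => //; exact: bigcupT_measurable.
Qed.

(** Cut [A] into pieces of finite measure. For such a piece take a measurable hull [F], and a hull
    [G] of the excess of [F] over the piece. Splitting [F] by the Caratheodory condition gives
    [mu F = mu F + mu G]; as [mu F] is finite, [G] is null, and the piece agrees with [F] off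
    [G]. *)
Lemma caratheodory_measurable_approx (A : set T) :
  sigma_finite setT mu -> outer.-cara.-measurable A ->
  exists B N, [/\ measurable B, measurable N, mu N = 0%E &
    forall x, ~ N x -> A x <-> B x].
Proof.
move=> [S ST mS] mA.
have approx n : exists BN : set T * set T, [/\ measurable BN.1, measurable BN.2,
    mu BN.2 = 0%E & forall x, ~ BN.2 x -> (A `&` S n) x <-> BN.1 x].
  have [mSn Snoo] := mS n.
  have mASn : outer.-cara.-measurable (A `&` S n).
    apply: measurableI => //; apply: sub_caratheodory.
    exact: sub_sigma_algebra.
  have [F [mF AF muF]] := outer_measurable_hull (A `&` S n).
  have [G [mG FG muG]] := outer_measurable_hull (F `\` (A `&` S n)).
  exists (F, G); split => //= [|x nGx].
    have E : (mu F = mu F + mu G)%E.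
      rewrite [in RHS]muF muG -[in LHS](measurable_mu_extE mu)//.
      by apply: etrans (mASn F) _; rewrite (setIidr AF).
    have Ffin : mu F \is a fin_num.
      rewrite ge0_fin_numE// muF (le_lt_trans _ Snoo)//.
      by rewrite -(measurable_mu_extE mu)//; exact: le_mu_ext.
    by rewrite -[mu G]add0e -(subee Ffin) addeAC -E.
  split => [/AF//|Fx]; apply: contrapT => nA; apply: nGx.
  by apply: FG.
have [BN BNP] := choice approx.
exists (\bigcup_n (BN n).1), (\bigcup_n (BN n).2); split.
- by apply: bigcupT_measurable => n; have [] := BNP n.
- by apply: bigcupT_measurable => n; have [] := BNP n.
- by apply: measure0_bigcup => n; have [] := BNP n.
- move=> x nN; have nNn n : ~ (BN n).2 x by move=> Nx; apply: nN; exists n.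
  split => [Ax|[n _ Bx]].
    have [n _ Sx] : (\bigcup_i S i) x by rewrite -ST.
    by exists n => //; have [_ _ _ <-] := BNP n.
  by have [_ _ _ /(_ x (nNn n)) [_ /(_ Bx) []]] := BNP n.
Qed.

(** The superlevel sets for a dense sequence of levels are corrected by countably many null sets,
    whose union serves as [N]. Off [N] every superlevel set is a countable union of these. *)
Lemma caratheodory_measurable_fun_approx (D : set T) (g : T -> R) :
  sigma_finite setT mu ->
  (forall x : R, outer.-cara.-measurable (D `&` g @^-1` `]x, +oo[)) ->
  exists N, [/\ measurable N, mu N = 0%E & measurable_fun (D `\` N) g].
Proof.
move=> sf mg.
have [q q_dense] := @dense_rat_seq R.
have approx n : exists BN : set T * set T, [/\ measurable BN.1, measurable BN.2,
    mu BN.2 = 0%E &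
    forall x, ~ BN.2 x -> (D `&` g @^-1` `]q n, +oo[) x <-> BN.1 x].
  by have [B [N BNP]] := caratheodory_measurable_approx _ sf (mg (q n)); exists (B, N).
have [BN BNP] := choice approx.
have mN : measurable (\bigcup_n (BN n).2).
  by apply: bigcupT_measurable => n; have [] := BNP n.
exists (\bigcup_n (BN n).2); split => //.
  by apply: measure0_bigcup => n; have [] := BNP n.
move=> mDN; apply: (measurability _ (RGenOInfty.measurableE R)) => // _ [_ [x ->] <-].
rewrite [X in measurable X](_ : _ =
    \bigcup_(n in [set n | x <= q n]) ((BN n).1 `\` \bigcup_n (BN n).2)).
  apply: bigcup_measurable => n _; apply: measurableD => //.
  by have [] := BNP n.
apply/seteqP; split => y.
  move=> [[Dy nN]]; rewrite /= in_itv/= andbT => /q_dense[n /andP[xq qg]].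
  exists n; first exact: ltW.
  split => //; have [_ _ _ <-] := BNP n; first by split; rewrite //= in_itv/= qg.
  by move=> Ny; apply: nN; exists n.
move=> [n /= xq [By nN]].
have : (D `&` g @^-1` `]q n, +oo[) y.
  by have [_ _ _ ->] := BNP n => // Ny; apply: nN; exists n.
move=> [Dy]; rewrite /= !in_itv/= !andbT => qg.
by split => //; exact: le_lt_trans qg.
Qed.

End completion.

(** The intended [phi] is the identity from the sigma-algebra of a completion to the Borel one:
    completing a measure does not change the integral of a Borel function. The signed case follows
    by taking positive and negative parts. *)
Lemma integral_transfer d1 d2 (X : measurableType d1) (Y : measurableType d2)
    (R : realType) (phi : X -> Y) (mu : {measure set X -> \bar R})
    (nu : {measure set Y -> \bar R}) (D : set Y) (f : Y -> \bar R) :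
  measurable_fun setT phi ->
  (forall A, measurable A -> nu A = mu (phi @^-1` A)) ->
  measurable D -> measurable_fun D f ->
  (\int[nu]_(y in D) f y = \int[mu]_(x in phi @^-1` D) f (phi x))%E.
Proof.
move=> mphi nuE mD mf.
have ge0 (g : Y -> \bar R) : measurable_fun D g -> (forall y, (0 <= g y)%E) ->
    (\int[nu]_(y in D) g y = \int[mu]_(x in phi @^-1` D) g (phi x))%E.
  move=> mg g0; rewrite -(ge0_integral_pushforward mphi _ mD mg)//.
  by apply: eq_measure_integral => A mA _; exact: nuE.
rewrite integralE [RHS]integralE (ge0 (f^\+)%E); last 2 first.
- exact: measurable_funepos.
- exact: funepos_ge0.
rewrite (ge0 (f^\-)%E)//; last exact: measurable_funeneg.
by congr (_ - _)%E; apply: eq_integral => x _; rewrite ?funeposE ?funenegE.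
Qed.

Section completed.
Context {R : realType}.
Notation mu := (@lebesgue_measure R).

Lemma measurable_completed_lebesgue (A : set R) :
  measurable (A : set (measurableTypeR R)) ->
  (wlength (@idfun R))^*%mu.-cara.-measurable A.
Proof. exact: sub_caratheodory. Qed.

Lemma integral_completed_lebesgue (D : set R) (f : R -> \bar R) :
  measurable (D : set (measurableTypeR R)) -> measurable_fun (D : set (measurableTypeR R)) f ->
  (\int[mu]_(x in D) f x = \int[@completed_lebesgue_measure R]_(x in D) f x)%E.
Proof.
move=> mD mf.
refine (@integral_transfer _ _ (caratheodory_type ((wlength (@idfun R))^*)%mu)
  (measurableTypeR R) R (fun x => x) (@completed_lebesgue_measure R) mu D f _ _ mD mf).
  by move=> _ A mA; rewrite setTI; exact: measurable_completed_lebesgue.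
by [].
Qed.

Lemma integral_lebesgue2 (D : set (measurableTypeR R * measurableTypeR R)) (f : R * R -> \bar R) :
  measurable D -> measurable_fun D f ->
  (\int[mu \x mu]_(x in D) f x = \int[@lebesgue_measure2 R]_(x in D) f x)%E.
Proof.
move=> mD mf.
refine (@integral_transfer _ _ (caratheodory_type ((mu \x mu)%E^*)%mu)
  (measurableTypeR R * measurableTypeR R)%type R (fun x => x)
  (@lebesgue_measure2 R) (mu \x mu)%E D f _ _ mD mf).
  by move=> _ A mA; rewrite setTI; apply: sub_caratheodory; exact: sub_sigma_algebra.
by move=> A mA; rewrite /lebesgue_measure2 /= -(measurable_mu_extE (mu \x mu)%E).
Qed.

(** The plane has a countable base of rational open boxes, so [O] is a countable union of measurable
    rectangles. *)
Lemma open_measurable_prod (O : set (R * R)) : open O ->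
  measurable (O : set (measurableTypeR R * measurableTypeR R)).
Proof.
move=> oO.
pose rect (q : (rat * rat) * (rat * rat)) : set (R * R) :=
  `]ratr q.1.1, ratr q.1.2[%classic `*` `]ratr q.2.1, ratr q.2.2[%classic.
pose G q : set (R * R) := if `[< rect q `<=` O >] then rect q else set0.
have mG q : measurable (G q : set (measurableTypeR R * measurableTypeR R)).
  by rewrite /G; case: ifPn => // _; apply: measurableX.
pose F n : set (measurableTypeR R * measurableTypeR R) :=
  if unpickle n is Some q then G q else set0.
have -> : O = \bigcup_n F n.
  apply/seteqP; split => [[x y] Oxy|p [n _]]; last first.
    rewrite /F; case: unpickle => [q|//].
    by rewrite /G; case: ifPn => // /asboolP; apply.
  have /nbhs_ballP[e /= e0 sub] : nbhs (x, y) O by exact: open_nbhs_nbhs.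
  have rat_near (z : R) : exists p q : rat,
      [/\ z - e < ratr p, ratr p < z, z < ratr q & ratr q < z + e].
    have [|p] := @rat_in_itvoo R (z - e) z; first by rewrite ltrBlDr ltrDl.
    rewrite in_itv/= => /andP[zp pz].
    have [|q] := @rat_in_itvoo R z (z + e); first by rewrite ltrDl.
    by rewrite in_itv/= => /andP[zq qz]; exists p, q.
  have [p1 [q1 [xp1 p1x xq1 q1x]]] := rat_near x.
  have [p2 [q2 [yp2 p2y yq2 q2y]]] := rat_near y.
  pose q := ((p1, q1), (p2, q2)).
  have qO : rect q `<=` O.
    move=> [z w] [/=]; rewrite !in_itv/= => /andP[pz zq] /andP[pw wq].
    apply: sub; split; rewrite /ball/= ltr_distlC.
      by rewrite (lt_trans xp1 pz) (lt_trans zq q1x).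
    by rewrite (lt_trans yp2 pw) (lt_trans wq q2y).
  exists (pickle q); first exact: Logic.I.
  rewrite /F pickleK /G; case: ifPn => [_|/asboolP//].
  by split; rewrite /= in_itv/= ?p1x ?p2y.
by apply: bigcupT_measurable => n; rewrite /F; case: unpickle => [q|//]; exact: mG.
Qed.

End completed.

(** * The curved side makes less than one turn *)

Section clamp.
Context {R : realType}.

(** Retraction of the line onto a segment. Composition with it turns continuity within the segment
    into continuity everywhere. *)
Definition clamp (a b x : R) : R := Num.max a (Num.min x b).

Lemma clampP a b x : a <= b -> clamp a b x \in `[a, b].
Proof.
by move=> ab; rewrite in_itv/= /clamp le_max lexx/= ge_max ab ge_min lexx orbT.
Qed.

Lemma clamp_id a b x : x \in `[a, b] -> clamp a b x = x.
Proof.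
by rewrite in_itv/= => /andP[ax xb]; rewrite /clamp (min_idPl xb) (max_idPr ax).
Qed.

Lemma continuous_clamp_comp (T : topologicalType) (f : R -> T) a b : a <= b ->
  {within `[a, b], continuous f} -> continuous (f \o clamp a b).
Proof.
move=> ab /subspace_continuousP cf x.
have cc : {for x, continuous (clamp a b)}.
  apply: (@continuous_max _ _ (cst a)); first exact: cst_continuous.
  by apply: (@continuous_min _ _ id (cst b)); [move=> ?|exact: cst_continuous].
have xab := clampP _ _ x ab.
apply: cvg_comp (cf _ xab).
move=> P wP.
have near_x : nbhs x (fun y => clamp a b y \in `[a, b] -> P (clamp a b y)).
  exact: (cc (fun z => z \in `[a, b] -> P z) wP).
by apply: filterS near_x => y; apply; exact: clampP.
Qed.

End clamp.

Section turn.
Context {R : realType}.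
Variables (v : R * R) (L : R) (gamma : R -> R * R).
Hypothesis L0 : 0 < L.
Hypothesis Jcurve : simple_closed_curve 0 (L + 2) (mesh_boundary v L gamma).

Lemma mesh_boundary_gamma s : 0 <= s <= L -> mesh_boundary v L gamma (1 + s) = gamma s.
Proof.
move=> /andP[s0 sL]; rewrite /mesh_boundary.
have [s1|s1] := leP (1 + s) 1.
  have -> : s = 0 by apply/eqP; rewrite eq_le s0 andbT; move: s1; rewrite gerDl.
  by rewrite addr0 scale1r addrC subrK.
by rewrite lerD2l sL addrAC subrr add0r.
Qed.

Let bI : {in `[0, L + 2[ &, injective (mesh_boundary v L gamma)}.
Proof. by case: Jcurve. Qed.

Let in_bI s : 0 <= s <= L -> 1 + s \in `[0, L + 2[.
Proof. by move=> /andP[s0 sL]; rewrite in_itv/=; apply/andP; split; lra. Qed.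

Lemma mesh_curve_inj s t : 0 <= s <= L -> 0 <= t <= L -> gamma s = gamma t -> s = t.
Proof.
move=> sL tL; rewrite -!mesh_boundary_gamma// => /bI.
by move=> /(_ (in_bI _ sL) (in_bI _ tL)) /addrI.
Qed.

Lemma mesh_curve_neq_first s w : 0 < s <= L -> 0 <= w <= 1 ->
  gamma s <> v + w *: (gamma 0 - v).
Proof.
move=> /andP[s0 sL] /andP[w0 w1].
have sL' : 0 <= s <= L by rewrite ltW.
rewrite -mesh_boundary_gamma//.
have -> : v + w *: (gamma 0 - v) = mesh_boundary v L gamma w.
  by rewrite /mesh_boundary w1.
have wI : w \in `[0, L + 2[ by rewrite in_itv/=; apply/andP; split; lra.
by move=> /bI => /(_ (in_bI _ sL') wI); lra.
Qed.

Lemma mesh_curve_neq_v s : 0 <= s <= L -> gamma s <> v.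
Proof.
move=> sL; rewrite -mesh_boundary_gamma//.
have {2}<- : mesh_boundary v L gamma 0 = v.
  by rewrite /mesh_boundary ler01 scale0r addr0.
have I0 : 0 \in `[0, L + 2[ by rewrite in_itv/= lexx/=; lra.
move=> /bI => /(_ (in_bI _ sL) I0); move/andP: sL => [s0 _]; lra.
Qed.

(** The case [w = 1] is the end of the curve itself. For [w < 1] the point lies on the last side, at
    boundary parameter [1 + L + (1 - w)]; [w > 0] keeps this below [L + 2], where injectivity
    ends. *)
Lemma mesh_curve_neq_last s w : 0 <= s < L -> 0 < w <= 1 ->
  gamma s <> v + w *: (gamma L - v).
Proof.
move=> /andP[s0 sL] /andP[w0 w1].
have sL' : 0 <= s <= L by rewrite s0 ltW.
have LL : 0 <= L <= L by rewrite lexx ltW.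
have [we|wn] := eqVneq w 1.
  rewrite we scale1r [v + _]addrC subrK => /mesh_curve_inj => /(_ sL' LL) sE.
  by move: sL; rewrite sE ltxx.
have wl : w < 1 by rewrite lt_neqAle wn.
rewrite -(mesh_boundary_gamma s)//.
have -> : v + w *: (gamma L - v) = mesh_boundary v L gamma (1 + L + (1 - w)).
  rewrite /mesh_boundary ifF; last by apply/negbTE; rewrite -ltNge; lra.
  rewrite ifF; last by apply/negbTE; rewrite -ltNge; lra.
  rewrite (_ : 1 + L + (1 - w) - 1 - L = 1 - w); last by ring.
  by rewrite scalerBl scale1r addrA [gamma L + (_ - _)]addrC subrK -scalerN opprB.
have wI : 1 + L + (1 - w) \in `[0, L + 2[ by rewrite in_itv/=; apply/andP; split; lra.
by move=> /bI => /(_ (in_bI _ sL') wI); lra.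
Qed.

(* e is the direction as a function of the angle, with period P; taking
   e x = (cos (- x), sin (- x)) covers the curves with decreasing angle. *)
Lemma no_full_turn (r0 theta : R -> R) (e : R -> R * R) (P : R) :
  (forall x, e (x + P) = e x) -> 0 < P ->
  {within `[0, L], continuous theta} ->
  {in `[0, L] &, {homo theta : s t / s < t >-> s < t}} ->
  {within `[0, L], continuous r0} ->
  (forall s, s \in `[0, L] -> 0 < r0 s) ->
  (forall s, s \in `[0, L] -> gamma s = v + r0 s *: e (theta s)) ->
  theta L < theta 0 + P.
Proof.
move=> eP P0 ctheta mtheta cr r0_gt0 gE.
rewrite ltNge; apply/negP => full.
have mono : {in `[0, L] &, {mono theta : s t / s <= t}} by exact: le_mono_in.
have injt : {in `[0, L] &, injective theta} by exact: inc_inj_in.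
have I0 : 0 \in `[0, L] by rewrite in_itv/= lexx ltW.
have IL : L \in `[0, L] by rewrite in_itv/= lexx ltW.
have t0L : theta 0 <= theta L by rewrite mono// ltW.
(* This yields an inverse [G] of [theta], total because its value outside the range of [theta] is
   arbitrary. *)
have invt x : exists s, x \in `[theta 0, theta L] -> s \in `[0, L] /\ theta s = x.
  have [xI|/negP nx] := boolP (x \in `[theta 0, theta L]); last by exists 0.
  have [|s sI sx] := @IVT R theta 0 L x (ltW L0) ctheta.
    by rewrite minEle maxEle t0L; move: xI; rewrite in_itv.
  by exists s.
have [G GP] := choice invt.
have GK : {in `[0, L], cancel theta G}.
  move=> s sI; have tI : theta s \in `[theta 0, theta L].
    by move: sI (sI); rewrite {1}in_itv/= => /andP[s0 sL] sI; rewrite in_itv/= !mono// s0.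
  by have [GI Gt] := GP _ tI; exact: injt.
have cG : {within `[theta 0, theta L], continuous G}.
  exact: segment_can_le_continuous (ltW L0) ctheta GK.
(* The radius as a function of the angle; the clamps make it continuous on the whole line. *)
pose rho x := r0 (clamp 0 L (G (clamp (theta 0) (theta L) x))).
have crho : continuous rho.
  move=> x.
  apply: (@continuous_comp _ _ _ (G \o clamp (theta 0) (theta L)) (r0 \o clamp 0 L)).
    exact: (continuous_clamp_comp _ _ _ _ t0L cG).
  exact: (continuous_clamp_comp _ _ _ _ (ltW L0) cr).
have rhoE x : x \in `[theta 0, theta L] -> rho x = r0 (G x).
  by move=> xI; rewrite /rho (clamp_id _ _ _ xI) clamp_id//; have [] := GP x xI.
(* Difference of the radii one turn apart; at a zero the curve meets itself. *)
pose D x := rho (x + P) - rho x.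
have cD : continuous D.
  move=> x; apply: cvgB; last exact: crho.
  apply: (@continuous_comp _ _ _ (fun x => x + P) rho); last exact: crho.
  by apply: cvgD; [exact: cvg_id|exact: cvg_cst].
have ab : theta 0 <= theta L - P by rewrite lerBrDr.
have G0 : G (theta 0) = 0 by rewrite GK.
have GL : G (theta L) = L by rewrite GK.
have I1 x : theta 0 <= x <= theta L - P -> x \in `[theta 0, theta L].
  by move=> /andP[x0 xL]; rewrite in_itv/=; apply/andP; split; lra.
have I2 x : theta 0 <= x <= theta L - P -> x + P \in `[theta 0, theta L].
  by move=> /andP[x0 xL]; rewrite in_itv/=; apply/andP; split; lra.
have G_neq x : theta 0 <= x <= theta L - P -> G (x + P) != G x.
  move=> xI; apply/eqP => /(congr1 theta).
  have [_ ->] := GP _ (I2 _ xI); have [_ ->] := GP _ (I1 _ xI); lra.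
have gG x : theta 0 <= x <= theta L - P -> 
    gamma (G (x + P)) = v + (r0 (G (x + P)) / r0 (G x)) *: (gamma (G x) - v).
  move=> xI; have [i1 e1] := GP _ (I1 _ xI); have [i2 e2] := GP _ (I2 _ xI).
  rewrite gE// [in RHS]gE// e1 e2 eP addrAC subrr add0r scalerA divfK//.
  by rewrite gt_eqF// r0_gt0.
(* Otherwise the point one turn after the start would be no farther from [v] than [gamma 0], hence
   on the first side. *)
have D0 : 0 < D (theta 0).
  have xI : theta 0 <= theta 0 <= theta L - P by rewrite lexx.
  have [i2 _] := GP _ (I2 _ xI).
  have := gG _ xI; have := G_neq _ xI; rewrite /D (rhoE _ (I1 _ xI)) (rhoE _ (I2 _ xI)) G0 => n0 gs.
  rewrite subr_gt0 ltNge; apply/negP => le.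
  apply: (mesh_curve_neq_first (G (theta 0 + P)) (r0 (G (theta 0 + P)) / r0 0)); last exact: gs.
    by move: i2; rewrite in_itv/= lt_neqAle eq_sym n0.
  apply/andP; split; last by rewrite ler_pdivrMr ?r0_gt0// mul1r.
  by rewrite ltW// divr_gt0 ?r0_gt0.
(* Otherwise the point one turn before the end would lie on the last side. *)
have DL : D (theta L - P) < 0.
  have xI : theta 0 <= theta L - P <= theta L - P by rewrite lexx andbT.
  have [i1 _] := GP _ (I1 _ xI).
  have := gG _ xI; have := G_neq _ xI.
  rewrite /D (rhoE _ (I1 _ xI)) (rhoE _ (I2 _ xI)) subrK GL => n0 gs.
  rewrite subr_lt0 ltNge; apply/negP => le.
  apply: (mesh_curve_neq_last (G (theta L - P)) (r0 (G (theta L - P)) / r0 L)).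
  - move: i1; rewrite in_itv/= => /andP[-> le'] /=.
    by rewrite lt_neqAle eq_sym n0.
  - by rewrite divr_gt0 ?r0_gt0//= ler_pdivrMr ?r0_gt0// mul1r.
  - rewrite gs [v + _ - v]addrAC subrr add0r scalerA.
    rewrite (_ : _ / _ * _ = 1) ?scale1r; first by rewrite [v + _]addrC subrK.
    by field; rewrite !gt_eqF ?r0_gt0.
have [|x xI Dx] := @IVT R D (theta 0) (theta L - P) 0 ab (continuous_subspaceT cD).
  by rewrite minEle maxEle [D _ <= D _]leNgt (lt_trans DL D0)/= !ltW.
have xI' : theta 0 <= x <= theta L - P by move: xI; rewrite in_itv.
have [i1 e1] := GP _ (I1 _ xI'); have [i2 e2] := GP _ (I2 _ xI').
move/eqP : Dx; rewrite subr_eq0 (rhoE _ (I1 _ xI')) (rhoE _ (I2 _ xI')) => /eqP rE.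
have /negP := G_neq _ xI'; apply; apply/eqP; apply: mesh_curve_inj.
- by move: i2; rewrite in_itv.
- by move: i1; rewrite in_itv.
by rewrite gG// rE divff ?scale1r ?gt_eqF ?r0_gt0// [v + _]addrC subrK.
Qed.

End turn.

(** By the double angle formula [sin] vanishes at [|u| / 2], but it is positive strictly between [0]
    and [pi]. *)
Lemma cos_eq1 {R : realType} (u : R) : cos u = 1 -> `|u| < pi *+ 2 -> u = 0.
Proof.
move=> cu uP; apply/eqP/negP => /negP u0.
have w0 : 0 < `|u| / 2 by rewrite divr_gt0// normr_gt0.
have wpi : `|u| / 2 < pi by rewrite ltr_pdivrMr// mulr_natr.
have : 0 < sin (`|u| / 2) by apply: sin_gt0_pi; rewrite w0.
have cw : cos `|u| = 1 by case: (ler0P u); rewrite ?cosN.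
move: cw; rewrite {1}[`|u|]splitr cosD -!expr2 => cw.
have := cos2Dsin2 (`|u| / 2) => cs.
nra.
Qed.

Section direction.
Context {R : realType}.
Variables (v : R * R) (L : R) (gamma : R -> R * R) (r0 theta : R -> R).
Hypothesis L0 : 0 < L.
Hypothesis Jcurve : simple_closed_curve 0 (L + 2) (mesh_boundary v L gamma).
Hypothesis hr0 : forall s : R, s \in `[0, L] -> r0 s = enorm (gamma s - v).
Hypothesis htheta : {within `[0, L], continuous theta}.
Hypothesis hpolar : forall s, s \in `[0, L] -> gamma s = polar v (r0 s) (theta s).
Hypothesis hmono : {in `[0, L] &, {homo theta : s t / s < t >-> s < t}} \/
  {in `[0, L] &, {homo theta : s t / s < t >-> t < s}}.

Lemma continuous_mesh_curve : continuous (gamma \o clamp 0 L).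
Proof.
have -> : gamma \o clamp 0 L =
    (mesh_boundary v L gamma \o clamp 0 (L + 2)) \o (fun s => 1 + clamp 0 L s).
  apply/funext => s /=; have := clampP _ _ s (ltW L0).
  rewrite in_itv/= => sL; rewrite (clamp_id 0 (L + 2)) ?mesh_boundary_gamma//.
  by move/andP: sL => [s0 sL]; rewrite in_itv/=; apply/andP; split; lra.
move=> s; apply: continuous_comp.
  apply: cvgD; first exact: cvg_cst.
  apply: (@continuous_clamp_comp _ _ id _ _ (ltW L0)).
  by apply: continuous_subspaceT => x; exact: cvg_id.
have L2 : 0 <= L + 2 by rewrite addr_ge0// ltW.
by have [cJ _ _] := Jcurve; exact: (continuous_clamp_comp _ _ _ _ L2 cJ).
Qed.

Lemma continuous_enorm : continuous (@enorm R).
Proof.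
move=> p.
apply: (@continuous_comp _ _ _ (fun a : R * R => a.1 ^+ 2 + a.2 ^+ 2) Num.sqrt).
  have c1 : {for p, continuous (fst : R * R -> R)} by exact: cvg_fst.
  have c2 : {for p, continuous (snd : R * R -> R)} by exact: cvg_snd.
  by apply: cvgD; apply: cvgM.
exact: sqrt_continuous.
Qed.

Lemma radius_gt0 s : s \in `[0, L] -> 0 < r0 s.
Proof.
move=> sL; rewrite hr0// sqrtr_gt0 lt0r addr_ge0 ?sqr_ge0// andbT.
apply/eqP => /eqP; rewrite paddr_eq0 ?sqr_ge0// !sqrf_eq0 => /andP[/eqP e1 /eqP e2].
apply: (mesh_curve_neq_v _ _ _ Jcurve s); first by move: sL; rewrite in_itv.
apply/eqP; rewrite -subr_eq0; apply/eqP.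
by apply: injective_projections.
Qed.

(** By monotonicity the largest difference is the total angle, which [no_full_turn] bounds; for
    decreasing [theta] it is applied to [- theta]. The function [r] is a globally continuous version
    of [r0]. *)
Lemma angle_lt s t : s \in `[0, L] -> t \in `[0, L] -> `|theta t - theta s| < pi *+ 2.
Proof.
pose r s := enorm ((gamma \o clamp 0 L) s - v).
have cr : continuous r.
  move=> x; apply: (@continuous_comp _ _ _ (fun s => (gamma \o clamp 0 L) s - v)).
    by apply: cvgB; [exact: continuous_mesh_curve|exact: cvg_cst].
  exact: continuous_enorm.
have rE x : x \in `[0, L] -> r x = r0 x.
  by move=> xL; rewrite /r/= clamp_id// hr0.
have cwr : {within `[0, L], continuous r} by exact: continuous_subspaceT.
have r_gt0 x : x \in `[0, L] -> 0 < r x by move=> xL; rewrite rE// radius_gt0.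
have pi2_gt0 : 0 < pi *+ 2 :> R by rewrite pmulrn_lgt0// pi_gt0.
have I0 : 0 \in `[0, L] by rewrite in_itv/= lexx ltW.
have IL : L \in `[0, L] by rewrite in_itv/= lexx ltW.
move=> sL tL; have := sL; have := tL; rewrite !in_itv/= => /andP[t0 tL'] /andP[s0 sL'].
have [mono|mono] := hmono.
  have full := @no_full_turn _ v L gamma L0 Jcurve r theta
    (fun x => (cos x, sin x)) (pi *+ 2).
  have : theta L < theta 0 + pi *+ 2.
    apply: full => //.
      by move=> x; rewrite cosD2pi sinD2pi.
    by move=> x xL; rewrite hpolar// rE.
  have m : {in `[0, L] &, {mono theta : s t / s <= t}} by exact: le_mono_in.
  have := m _ _ I0 sL; have := m _ _ sL IL; have := m _ _ I0 tL; have := m _ _ tL IL.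
  rewrite s0 t0 sL' tL' => *.
  rewrite ltr_norml; apply/andP; split; lra.
have full := @no_full_turn _ v L gamma L0 Jcurve r (fun x => - theta x)
  (fun x => (cos (- x), sin (- x))) (pi *+ 2).
have : - theta L < - theta 0 + pi *+ 2.
  apply: full => //.
  - by move=> x; rewrite !cosN !sinN cosD2pi sinD2pi.
  - by move=> x; apply: cvgN; exact: htheta.
  - by move=> x y xL yL xy; rewrite ltrN2 mono.
  - by move=> x xL; rewrite hpolar// rE// opprK.
have m : {in `[0, L] &, {mono theta : s t /~ s <= t}}.
  by apply: le_nmono_in => x y xL yL; exact: mono.
have := m _ _ sL I0; have := m _ _ IL sL; have := m _ _ tL I0; have := m _ _ IL tL.
rewrite s0 t0 sL' tL' => *.
rewrite ltr_norml; apply/andP; split; lra.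
Qed.

(** Let [a] and [b] be the two angles. Scalar products with the two unit directions give
    [r0 t = k * r0 s * cos (a - b)] and [r0 t * cos (a - b) = k * r0 s]. Hence the cosine has square
    1, and it is positive, so it is 1. As the angles differ by less than a full turn they agree, and
    [theta] is injective. *)
Lemma mesh_direction_inj s t k : 0 <= s <= L -> 0 <= t <= L -> 0 < k ->
  (gamma t).1 - v.1 = k * ((gamma s).1 - v.1) ->
  (gamma t).2 - v.2 = k * ((gamma s).2 - v.2) -> s = t.
Proof.
move=> sL tL k0.
have sI : s \in `[0, L] by rewrite in_itv.
have tI : t \in `[0, L] by rewrite in_itv.
rewrite (hpolar _ sI) (hpolar _ tI) /polar/= ![_ + _ * _ - _]addrAC !subrr !add0r.
have rs := radius_gt0 _ sI; have rt := radius_gt0 _ tI.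
move: (angle_lt _ _ sI tI).
set a := theta t; set b := theta s => ab E1 E2.
have csa := cos2Dsin2 a; have csb := cos2Dsin2 b.
have cab : cos (a - b) = cos a * cos b + sin a * sin b by rewrite cosB.
have F1 : r0 t = k * r0 s * cos (a - b).
  rewrite cab -[LHS]mulr1 -csa !expr2.
  transitivity (r0 t * cos a * cos a + r0 t * sin a * sin a); first by ring.
  rewrite E1 E2; ring.
have F2 : r0 t * cos (a - b) = k * r0 s.
  rewrite cab.
  transitivity (r0 t * cos a * cos b + r0 t * sin a * sin b); first by ring.
  rewrite E1 E2 -[RHS]mulr1 -csb !expr2; ring.
have C1 : cos (a - b) = 1.
  have X2 : cos (a - b) ^+ 2 = 1.
    by apply: (mulfI (lt0r_neq0 rt)); rewrite expr2 mulrA F2 mulr1 -F1.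
  have X0 : 0 < cos (a - b) by rewrite -(pmulr_rgt0 _ rt) F2 mulr_gt0.
  move/eqP : X2; rewrite sqrf_eq1 => /orP[/eqP//|/eqP XN].
  by move: X0; rewrite XN ltr0N1.
have /subr0_eq : a - b = 0 by exact: cos_eq1.
rewrite /a /b => tE.
have [mono|mono] := hmono; first exact: (inc_inj_in (le_mono_in mono)).
have m : {in `[0, L] &, {mono theta : s t /~ s <= t}}.
  by apply: le_nmono_in => x y xL yL; exact: mono.
exact: (dec_inj_in m).
Qed.

End direction.

(** * Null sets on rays *)

Section completed_ae.
Context {R : realType}.
Notation mu := (@lebesgue_measure R).
Notation cmu := (@completed_lebesgue_measure R).

(** Completeness makes [F] measurable, as it agrees with [G] off a null set; its integral is then
    that of [G], which completion does not change. *)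
Lemma integral_completed_ae_eq (D : set R) (F G : R -> \bar R) :
  measurable (D : set (measurableTypeR R)) ->
  measurable_fun (D : set (measurableTypeR R)) G ->
  mu.-negligible (D `&` [set x | F x != G x]) ->
  (\int[cmu]_(x in D) F x = \int[mu]_(x in D) G x)%E.
Proof.
move=> mD mG [M [mM M0 sub]].
rewrite integral_completed_lebesgue//.
have mcD := measurable_completed_lebesgue _ mD.
have mcG : measurable_fun (D : set (caratheodory_type (wlength (@idfun R))^*%mu)) G.
  by move=> _ A mA; apply: measurable_completed_lebesgue; exact: mG.
have aeFG : ae_eq cmu D G F.
  exists M; split => //.
  - exact: measurable_completed_lebesgue.
  - by move=> x /= /not_implyP[Dx GF]; apply: sub; split => //; apply/eqP => FG; apply: GF.
have mcF := ae_measurable_fun (@completed_lebesgue_measure_is_complete R) aeFG mcG.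
by apply: ae_eq_integral => //; exact: ae_eq_sym.
Qed.

(** The last hypothesis says that almost every point of the ray avoids [N], the weight [r] being
    positive. There [g] may be replaced by the Borel function [gt], whose integral splits into
    positive and negative parts. *)
Lemma ray_integral_completed (v w : R * R) (g : R * R -> R)
    (gt : R * R -> \bar R) (N : set (R * R)) :
  measurable (N : set (measurableTypeR R * measurableTypeR R)) ->
  measurable_fun [set: R * R] gt ->
  (forall r, 0 <= r <= 1 -> ~ N (v.1 + r * w.1, v.2 + r * w.2) ->
    gt (v.1 + r * w.1, v.2 + r * w.2) = (g (v.1 + r * w.1, v.2 + r * w.2))%:E) ->
  (\int[mu]_(r in `]0%R, 1%R[)
    ((\1_N (v.1 + r * w.1, v.2 + r * w.2)%R)%:E * r%:E) = 0)%E ->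
  (\int[cmu]_(r in `[0%R, 1%R]) (g (v.1 + r * w.1, v.2 + r * w.2) * r)%R%:E =
   \int[mu]_(r in `]0%R, 1%R[) (gt^\+ (v.1 + r * w.1, v.2 + r * w.2)%R * r%:E) -
   \int[mu]_(r in `]0%R, 1%R[) (gt^\- (v.1 + r * w.1, v.2 + r * w.2)%R * r%:E))%E.
Proof.
move=> mN mgt gtE Q0.
pose Phi r : R * R := (v.1 + r * w.1, v.2 + r * w.2).
have mrad (h : R * R -> \bar R) : measurable_fun [set: R * R] h ->
    measurable_fun setT (fun r : R => (h (Phi r) * r%:E)%E).
  by move=> mh; exact: measurable_radial.
have mI : measurable_fun setT (fun r : R => ((\1_N (Phi r))%:E * r%:E)%E).
  by apply: (mrad (EFin \o \1_N)); apply/measurable_EFinP; exact: measurable_indic.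
have := mrad _ mgt => mG.
rewrite (@integral_completed_ae_eq _ _ (fun r => gt (Phi r) * r%:E)%E)//; last 2 first.
- exact: measurable_funTS.
- have : ae_eq mu `]0%R, 1%R[%classic (fun r => (\1_N (Phi r))%:E * r%:E)%E (cst 0%E).
    apply/ae_eq_integral_abs => //; first exact: measurable_funTS.
    rewrite -[RHS]Q0; apply: eq_integral => r; rewrite inE/= in_itv/= => /andP[r0 _].
    by rewrite -EFinM ger0_norm// mulr_ge0// ltW.
  move=> ae0.
  (* The end [r = 1] goes into the null set; at [r = 0] both integrands vanish because of the factor
     [r]. *)
  have n1 : mu.-negligible [set 1 : R].
    by exists [set 1]; split => //; exact: lebesgue_measure_set1.
  apply: negligibleS (negligibleU ae0 n1) => r /= [].
  rewrite in_itv/= => /andP[r0 r1] /eqP ne.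
  have [->|rn1] := eqVneq r 1; [by right|left].
  have [rE|rn0] := eqVneq r 0; first by exfalso; apply: ne; rewrite rE mulr0 mule0.
  have r01 : r \in `]0, 1[ by rewrite in_itv/= lt_neqAle eq_sym rn0 r0/= lt_neqAle rn1.
  move=> /(_ r01) /eqP; rewrite mule_eq0 !eqe (negbTE rn0) orbF => /eqP[].
  rewrite indicE => /eqP; rewrite pnatr_eq0 eqb0 notin_setE => nN.
  by apply: ne; rewrite /Phi gtE ?r0// EFinM.
rewrite integral_itv_bndoo; last exact: measurable_funTS.
rewrite integralE; congr (_ - _)%E; apply: eq_integral => r;
  rewrite inE/= in_itv/= => /andP[r0 r1].
- by rewrite !funeposE maxe_pMl ?mul0e// lee_fin ltW.
- by rewrite !funenegE maxe_pMl ?mul0e ?mulNe// lee_fin ltW.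
Qed.

End completed_ae.

(** * Derivatives at interior points and measurability of the star *)

Section interior.
Context {R : realType}.

Lemma within_near (T : Type) (F : set_system T) (D : set T) : Filter F ->
  F D -> within D F = F.
Proof.
move=> FF FD; apply/seteqP; split => P; rewrite /within/= => FP.
  by apply: filterS2 FD FP => x Dx; apply.
by apply: filterS FP.
Qed.

(** At an interior point small increments [h] stay in the segment, so the restricted difference
    quotient has the same limit as the usual one. *)
Lemma derive_within_interior (V : normedModType R) (g : R -> V) (L s : R) :
  0 < s < L -> derivable_within `[0, L] g s ->
  is_derive s 1 g (derive_within `[0, L] g s).
Proof.
move=> sL; rewrite /derivable_within /derive_within.
have nearD : (0 : R)^' [set h | `[0, L]%classic (h + s)].
  apply: nbhs_dnbhs.
  have : nbhs (0 + s) `]0, L[%classic.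
    by apply: open_nbhs_nbhs; split; [exact: itv_open|rewrite add0r /= in_itv].
  have ca : {for 0, continuous (fun h => h + s)}.
    by apply: cvgD; [exact: cvg_id|exact: cvg_cst].
  move=> /ca; apply: filterS => h /=; exact: subset_itv_oo_cc.
rewrite within_near//.
have -> : (fun h : R => h^-1 *: (g (h + s) - g s)) =
    (fun h => h^-1 *: ((g \o shift s) (h *: 1) - g s)).
  by apply/funext => h /=; rewrite [h *: 1]mulr1.
by move=> dg; apply: DeriveDef.
Qed.

Lemma is_derive_fst (g : R -> R * R) (s : R) (dg : R * R) :
  is_derive s 1 g dg -> is_derive s 1 (fst \o g) dg.1.
Proof.
move=> [dgs <-].
have cq : h^-1 *: (((fst \o g) \o shift s) (h *: 1) - (fst \o g) s) @[h --> 0^'] --> ('D_1 g s).1.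
  exact: (cvg_comp _ _ dgs (@cvg_fst _ _ _ _ _)).
by apply: DeriveDef; [apply/cvg_ex; eexists; exact: cq|exact: cvg_lim cq].
Qed.

Lemma is_derive_snd (g : R -> R * R) (s : R) (dg : R * R) :
  is_derive s 1 g dg -> is_derive s 1 (snd \o g) dg.2.
Proof.
move=> [dgs <-].
have cq : h^-1 *: (((snd \o g) \o shift s) (h *: 1) - (snd \o g) s) @[h --> 0^'] --> ('D_1 g s).2.
  exact: (cvg_comp _ _ dgs (@cvg_snd _ _ _ _ _)).
by apply: DeriveDef; [apply/cvg_ex; eexists; exact: cq|exact: cvg_lim cq].
Qed.

End interior.

(** The star is a continuous image of a compact rectangle, hence closed, hence Borel. *)
Lemma measurable_star {R : realType} (v : R * R) (G : R -> R * R) (L : R) :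
  continuous G ->
  measurable ([set y | exists s r, [/\ 0 <= s <= L, 0 <= r <= 1 &
    y = v + r *: (G s - v)]] : set (measurableTypeR R * measurableTypeR R)).
Proof.
move=> cG.
have -> : [set y | exists s r, [/\ 0 <= s <= L, 0 <= r <= 1 & y = v + r *: (G s - v)]] =
    (fun p : R * R => v + p.2 *: (G p.1 - v)) @` (`[0, L] `*` `[0, 1]).
  apply/seteqP; split => [_ [s [r [sL r1 ->]]]|_ [[s r] [/= sL r1] <-]].
    by exists (s, r) => //; split; rewrite /= in_itv.
  by exists s, r; split => //; move: sL r1; rewrite !in_itv.
rewrite -[X in measurable X]setCK; apply: measurableC; apply: open_measurable_prod.
apply: closed_openC; apply: compact_closed; first exact: norm_hausdorff.
apply: continuous_compact; last by apply: compact_setX; exact: segment_compact.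
apply: continuous_subspaceT => p.
apply: cvgD; first exact: cvg_cst.
apply: cvgZ; first exact: cvg_snd.
apply: cvgB; last exact: cvg_cst.
by apply: (@continuous_comp _ _ _ fst G); [exact: cvg_fst|exact: cG].
Qed.

Lemma sigma_finite_lebesgue2 {R : realType} :
  sigma_finite [set: measurableTypeR R * measurableTypeR R]
    (@lebesgue_measure R \x @lebesgue_measure R)%E.
Proof.
have /sigma_finiteP[F [FT ndF Foo]] := sigma_finiteT (@lebesgue_measure R).
exists (fun n => F n `*` F n).
  apply/esym/seteqP; split => // -[x y] _.
  have [i _ Fx] : (\bigcup_n F n) x by rewrite -FT.
  have [j _ Fy] : (\bigcup_n F n) y by rewrite -FT.
  exists (maxn i j) => //; split => /=.
    by move: Fx; apply/subsetPset/ndF; exact: leq_maxl.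
  by move: Fy; apply/subsetPset/ndF; exact: leq_maxr.
move=> n; have [mF Fn] := Foo n; split; first exact: measurableX.
by rewrite product_measure1E// lte_mul_pinfty// ge0_fin_numE.
Qed.

(** * The formula for the completed measures *)

Section star_shaped_completed.
Context {R : realType}.
Notation mu := (@lebesgue_measure R).
Notation cmu := (@completed_lebesgue_measure R).
Variables (v : R * R) (L : R) (c d dc dd : R -> R).
Hypothesis dirI : forall s t k, 0 <= s <= L -> 0 <= t <= L -> 0 < k ->
  c t = k * c s -> d t = k * d s -> s = t.
Hypothesis cd0 : forall s, 0 < s < L -> c s = 0 -> d s != 0.
Hypothesis dcE : forall s, 0 < s < L -> is_derive s 1 c (dc s).
Hypothesis ddE : forall s, 0 < s < L -> is_derive s 1 d (dd s).
Hypothesis cdc : forall s, 0 < s < L -> {for s, continuous dc}.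
Hypothesis cdd : forall s, 0 < s < L -> {for s, continuous dd}.

Let Phi r s : R * R := (v.1 + r * c s, v.2 + r * d s).
Let J s := `|c s * dd s - d s * dc s|.
Let star := [set y | exists s r, [/\ 0 <= s <= L, 0 <= r <= 1 & y = Phi r s]].

(** Since [star_integral] concerns nonnegative Borel functions, [g] is replaced by a Borel function
    [gt] that differs from it on the star only in a null set. The formula is applied to the positive
    and negative parts of [gt], and to the indicator of the null set in order to control the
    rays. *)
Lemma star_integral_completed (g : R * R -> R) :
  measurable (star : set (measurableTypeR R * measurableTypeR R)) ->
  (@lebesgue_measure2 R).-integrable star (EFin \o g) ->
  (\int[@lebesgue_measure2 R]_(y in star) (g y)%:E =
   \int[cmu]_(s in `[0%R, L])
     ((\int[cmu]_(r in `[0%R, 1%R]) (g (Phi r s) * r)%R%:E) * (J s)%:E))%E.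
Proof.
move=> mstar /integrableP[mg gfin].
have cara (A : set (R * R)) : measurable (A : set (measurableTypeR R * measurableTypeR R)) ->
    ((mu \x mu)%E^*)%mu.-cara.-measurable A.
  by move=> mA; apply: sub_caratheodory; exact: sub_sigma_algebra.
have caraf (A : set (R * R)) (h : R * R -> \bar R) :
    measurable_fun (A : set (measurableTypeR R * measurableTypeR R)) h ->
    measurable (A : set (measurableTypeR R * measurableTypeR R)) ->
    measurable_fun (A : set (caratheodory_type ((mu \x mu)%E^*)%mu)) h.
  by move=> mh mA _ Y mY; apply: cara; exact: mh.
have [N [mN N0 mgN]] : exists N : set (measurableTypeR R * measurableTypeR R),
    [/\ measurable N, (mu \x mu)%E N = 0%E & measurable_fun (star `\` N) g].
  apply: (caratheodory_measurable_fun_approx _ _ _ _ _ _ sigma_finite_lebesgue2) => x.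
  have mg' : measurable_fun (star : set (caratheodory_type ((mu \x mu)%E^*)%mu)) g.
    exact/measurable_EFinP.
  exact: mg' (cara _ mstar) _ (measurable_itv _).
have mD : measurable (star `\` N : set (measurableTypeR R * measurableTypeR R)).
  exact: measurableD.
pose gt : R * R -> \bar R := (EFin \o g) \_ (star `\` N).
have mgt : measurable_fun [set: measurableTypeR R * measurableTypeR R] gt.
  apply: (measurable_restrictT _ mD).1; exact/measurable_EFinP.
have gt0 y : ~ star y -> gt y = 0%E.
  by move=> ny; rewrite /gt patchE memNset// => -[].
have gtE y : star y -> ~ N y -> gt y = (g y)%:E.
  by move=> sy nNy; rewrite /gt patchE mem_set.
have support (h : R * R -> \bar R) : (forall y, ~ star y -> h y = 0%E) ->
    forall y, h y != 0%E -> exists s r, [/\ 0 <= s <= L, 0 <= r <= 1 &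
      y = (v.1 + r * c s, v.2 + r * d s)].
  by move=> h0 y; apply: contra_neqP => ny; apply: h0.
have star_int h mh h0 hs :=
  @star_integral R v L c d dc dd h mh h0 hs dirI cd0 dcE ddE cdc cdd.
have mIJ h mh h0 :=
  @measurable_star_integrand R v L c d dc dd h mh h0 dcE ddE cdc cdd.
have p0 y : ~ star y -> gt^\+%E y = 0%E.
  by move=> /gt0; rewrite funeposE => ->; rewrite maxxx.
have n0 y : ~ star y -> gt^\-%E y = 0%E.
  by move=> /gt0; rewrite funenegE => ->; rewrite oppe0 maxxx.
have mp : measurable_fun [set: R * R] gt^\+%E by exact: measurable_funepos.
have mn : measurable_fun [set: R * R] gt^\-%E by exact: measurable_funeneg.
have Ip := star_int _ mp (funepos_ge0 gt) (support _ p0).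
have In := star_int _ mn (funeneg_ge0 gt) (support _ n0).
have le_abs y : star y -> (gt^\+ y <= `|(EFin \o g) y|)%E /\ (gt^\- y <= `|(EFin \o g) y|)%E.
  move=> sy; rewrite funeposE funenegE; have [Ny|nNy] := pselect (N y).
    have -> : gt y = 0%E by rewrite /gt patchE memNset// => -[].
    by rewrite oppe0 maxxx; split; exact: abse_ge0.
  rewrite gtE//= !ge_max !lee_fin normr_ge0 andbT ler_norm andbT.
  by rewrite -normrN ler_norm.
have toT (h : R * R -> \bar R) : (forall y, ~ star y -> h y = 0%E) ->
    (\int[mu \x mu]_(y in star) h y = \int[mu \x mu]_y h y)%E.
  move=> h0; rewrite integral_mkcond; apply: eq_integral => y _.
  by rewrite patchE; case: ifPn => //; rewrite notin_setE => /h0.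
have cstar := cara _ mstar.
(* Both parts are dominated by [|g|], so their integrals are finite and can be subtracted. *)
have fin (h : R * R -> \bar R) : measurable_fun [set: R * R] h ->
    (forall y, (0 <= h y)%E) -> (forall y, ~ star y -> h y = 0%E) ->
    (forall y, star y -> (h y <= `|(EFin \o g) y|)%E) ->
    (\int[mu \x mu]_y h y < +oo)%E.
  move=> mh h0 hs hg; rewrite -toT//.
  have mhs : measurable_fun (star : set (measurableTypeR R * measurableTypeR R)) h.
    exact: measurable_funTS.
  rewrite integral_lebesgue2//; apply: le_lt_trans gfin.
  have mabs := measurableT_comp (@abse_measurable R setT) mg.
  exact: (@ge0_le_integral _ _ _ (@lebesgue_measure2 R) star cstar h _
    (fun y _ => h0 y) (caraf _ _ mhs mstar) mabs hg).
have fp := fin _ mp (funepos_ge0 gt) p0 (fun y sy => (le_abs y sy).1).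
have fn := fin _ mn (funeneg_ge0 gt) n0 (fun y sy => (le_abs y sy).2).
pose I h s := (\int[mu]_(r in `]0%R, 1%R[) (h (v.1 + r * c s, v.2 + r * d s)%R * r%:E))%E.
have IJ0 (h : R * R -> \bar R) s : (forall y, (0 <= h y)%E) -> (0 <= I h s)%E.
  move=> h0; apply: integral_ge0 => r; rewrite /= in_itv/= => /andP[r0 _].
  by rewrite mule_ge0// lee_fin ltW.
have intIJ (h : R * R -> \bar R) : measurable_fun [set: R * R] h ->
    (forall y, (0 <= h y)%E) -> (forall y, ~ star y -> h y = 0%E) ->
    (\int[mu \x mu]_y h y < +oo)%E ->
    mu.-integrable `]0, L[%classic (fun s => I h s * (J s)%:E)%E.
  move=> mh h0 hs hfin; apply/integrableP; split; first exact: mIJ.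
  rewrite (star_int _ mh h0 (support _ hs)) in hfin.
  apply: le_lt_trans hfin; rewrite le_eqVlt; apply/orP; left; apply/eqP.
  by apply: eq_integral => s _; rewrite gee0_abs// mule_ge0 ?IJ0 ?lee_fin ?normr_ge0.
have ip := intIJ _ mp (funepos_ge0 gt) p0 fp.
have in_ := intIJ _ mn (funeneg_ge0 gt) n0 fn.
pose NS : set (measurableTypeR R * measurableTypeR R) := N `&` star.
have mNS : measurable NS by exact: measurableI.
pose h1 : R * R -> \bar R := EFin \o \1_NS.
have mh1 : measurable_fun [set: R * R] h1 by apply/measurable_EFinP; exact: measurable_indic.
have h10 y : (0 <= h1 y)%E by rewrite lee_fin.
have h1s y : ~ star y -> h1 y = 0%E.
  by move=> ny; rewrite /h1/= indicE memNset// => -[].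
(* Almost every ray meets the exceptional set NS in a null set. *)
have aeQ : ae_eq mu `]0, L[%classic (fun s => I h1 s * (J s)%:E)%E (cst 0%E).
  apply/ae_eq_integral_abs => //; first exact: mIJ.
  transitivity (\int[mu \x mu]_y h1 y)%E.
    rewrite (star_int _ mh1 h10 (support _ h1s)); apply: eq_integral => s _.
    by rewrite gee0_abs// mule_ge0 ?IJ0 ?lee_fin ?normr_ge0.
  rewrite integral_indic// setIT.
  by apply: (subset_measure0 _ _ _ N0) => //; exact: subIsetl.
pose W s := (I gt^\+ s * (J s)%:E - I gt^\- s * (J s)%:E)%E.
have mI : measurable (`]0, L[%classic : set (measurableTypeR R)) by [].
have mW : measurable_fun (`]0, L[%classic : set (measurableTypeR R)) W.
  by apply: emeasurable_funB; [exact: (measurable_int _ ip)|exact: (measurable_int _ in_)].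
have mWT : measurable_fun setT (W \_ `]0, L[) by exact: (measurable_restrictT _ mI).1.
rewrite (@integral_completed_ae_eq _ _ _ (W \_ `]0, L[))//; last 2 first.
- exact: measurable_funTS.
- have aep := integrable_ae mI ip; have aen := integrable_ae mI in_.
  have n0' : mu.-negligible [set 0 : R].
    by exists [set 0]; split => //; exact: lebesgue_measure_set1.
  have nL : mu.-negligible [set L : R].
    by exists [set L]; split => //; exact: lebesgue_measure_set1.
  (* The exceptional parameters are those whose ray meets the null set too much, those where the
     integrand of one part is infinite, and the two endpoints. *)
  apply: negligibleS (negligibleU (negligibleU aeQ (negligibleU aep aen)) (negligibleU n0' nL)).
  move=> s /= [sL ne].
  have [->|s0] := eqVneq s 0; first by right; left.
  have [->|sL'] := eqVneq s L; first by right; right.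
  have sI : s \in `]0, L[.
    by move: sL; rewrite !in_itv/= !lt_neqAle eq_sym s0 sL'.
  left; apply: contrapT => /not_orP[/contrapT Q0 /not_orP[/contrapT p /contrapT n]].
  move/eqP : ne; apply.
  have {}Q0 := Q0 sI; have {}p := p sI; have {}n := n sI.
  rewrite patchE mem_set// /W.
  (* If J s = 0 nothing is known about g on the ray, and its integral may be
     infinite, but the product by 0 is 0 in the extended reals. *)
  have [J0|Jn0] := eqVneq (J s) 0; first by rewrite J0 !mule0 sube0.
  have Jgt0 : 0 < J s by rewrite lt_neqAle eq_sym Jn0 /J normr_ge0.
  (* With a positive Jacobian, finiteness of the product passes to the radial integral, so the
     product distributes over the difference. *)
  have Ifin h : (forall y, (0 <= h y)%E) -> (I h s * (J s)%:E)%E \is a fin_num ->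
      I h s \is a fin_num.
    move=> h0; have := IJ0 _ s h0; case: (I h s) => // _.
    by rewrite gt0_mulye ?lte_fin.
  have sL2 : 0 <= s <= L by move: sL; rewrite in_itv.
  have -> : (\int[cmu]_(r in `[0%R, 1%R]) (g (Phi r s) * r)%R%:E =
      I gt^\+ s - I gt^\- s)%E.
    apply: (@ray_integral_completed R v (c s, d s) g gt NS) => //=.
      move=> r r01 nN; have sP : star (Phi r s) by exists s, r.
      by apply: gtE => // NP; apply: nN; split.
    by move/eqP : Q0; rewrite mule_eq0 eqe (negbTE Jn0) orbF => /eqP.
  have Fn := Ifin _ (funeneg_ge0 gt) n.
  by rewrite muleBl// fin_num_adde_defl// fin_numN.
rewrite integral_itv_bndoo; last exact: measurable_funTS.
transitivity (\int[mu]_(s in `]0%R, L[) W s)%E; last first.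
  by apply: eq_integral => s sI; rewrite patchE sI.
(* Read backwards, the formula for the two parts gives the plane integral of [gt], which equals [g]
   on the star off [N]. *)
rewrite integralB// -Ip -In -integralE -toT//.
rewrite integral_lebesgue2//; last exact: measurable_funTS.
apply: ae_eq_integral => //.
  by apply: caraf => //; exact: measurable_funTS.
exists N; split => //.
- exact: cara.
- by rewrite /lebesgue_measure2 /= -N0 -(measurable_mu_extE (mu \x mu)%E).
- move=> y /= /not_implyP[sy ne]; apply: contrapT => nNy; apply: ne.
  by rewrite gtE.
Qed.

End star_shaped_completed.

(** * The mesh element as a star-shaped set *)

Theorem theorem3p2 (R : realType) (v : R * R) (L : R) (gamma : R -> R * R)
    (Delta : set (R * R)) (r0 theta : R -> R) (f : R * R -> R)
    (hmesh : mesh_element Delta v L gamma)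
    (hr0 : forall s : R, s \in `[0, L] -> r0 s = enorm (gamma s - v))
    (htheta : {within `[0, L], continuous theta})
    (hpolar : forall s : R, s \in `[0, L] -> gamma s = polar v (r0 s) (theta s))
    (hDelta : Delta = [set y | exists s r : R,
       [/\ 0 <= s <= L, 0 <= r <= r0 s & y = polar v r (theta s)]])
    (hf : (@lebesgue_measure2 R).-integrable Delta
       (fun y : R * R => (ln (enorm (v - y)) * f y)%:E))
    (hmono : {in `[0, L] &, {homo theta : s t / s < t >-> s < t}} \/
             {in `[0, L] &, {homo theta : s t / s < t >-> t < s}}) :
  (\int[@lebesgue_measure2 R]_(y in Delta) (ln (enorm (v - y)) * f y)%R%:E =
   \int[@completed_lebesgue_measure R]_(s in `[0%R, L])
     ((\int[@completed_lebesgue_measure R]_(r in `[0%R, 1%R])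
         (ln (r0 s * r) * f (polar v (r0 s * r) (theta s)) * r)%R%:E) *
      `|cross (gamma s - v) (derive_within `[0, L] gamma s)|%R%:E))%E.
Proof.
have [L0 smooth _ Jcurve _] := hmesh.
have rgt0 := @radius_gt0 _ v L gamma r0 Jcurve hr0.
pose G := gamma \o clamp 0 L.
have GE s : 0 <= s <= L -> G s = gamma s by move=> sL; rewrite /G/= clamp_id// in_itv.
pose dg := derive_within `[0, L] gamma.
pose c s := (gamma s).1 - v.1.
pose d s := (gamma s).2 - v.2.
have dgE s : 0 < s < L -> is_derive s 1 gamma (dg s).
  move=> sL; apply: derive_within_interior => //; apply: (smooth 0%N s).
  by rewrite /= in_itv/=; move/andP : sL => [/ltW -> /ltW ->].
(* The second derivative exists, so the first one is continuous inside the segment. *)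
have cdg s : 0 < s < L -> {for s, continuous dg}.
  move=> sL; have [ddg _] : is_derive s 1 dg (derive_within `[0, L] dg s).
    apply: derive_within_interior => //; apply: (smooth 1%N s).
    by rewrite /= in_itv/=; move/andP : sL => [/ltW -> /ltW ->].
  exact/differentiable_continuous/derivable1_diffP.
have dcE s : 0 < s < L -> is_derive s 1 c (dg s).1.
  move=> sL; have := is_derive_fst _ _ _ (dgE s sL) => d1.
  have -> : c = (fst \o gamma) - cst v.1 by apply/funext.
  by rewrite -[(dg s).1]subr0; apply: is_deriveB.
have ddE s : 0 < s < L -> is_derive s 1 d (dg s).2.
  move=> sL; have := is_derive_snd _ _ _ (dgE s sL) => d1.
  have -> : d = (snd \o gamma) - cst v.2 by apply/funext.
  by rewrite -[(dg s).2]subr0; apply: is_deriveB.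
have cdc s : 0 < s < L -> {for s, continuous (fun s => (dg s).1)}.
  move=> /cdg cs; apply: (@continuous_comp _ _ _ dg fst); first exact: cs.
  exact: cvg_fst.
have cdd s : 0 < s < L -> {for s, continuous (fun s => (dg s).2)}.
  move=> /cdg cs; apply: (@continuous_comp _ _ _ dg snd); first exact: cs.
  exact: cvg_snd.
have dirI s t k : 0 <= s <= L -> 0 <= t <= L -> 0 < k ->
    c t = k * c s -> d t = k * d s -> s = t.
  exact: (mesh_direction_inj _ _ _ _ _ L0 Jcurve hr0 htheta hpolar hmono).
have cd0 s : 0 < s < L -> c s = 0 -> d s != 0.
  move=> /andP[/ltW s0 /ltW sL] cs; apply/eqP => ds.
  apply: (mesh_curve_neq_v _ _ _ Jcurve s); first by rewrite s0.
  by apply: injective_projections; apply/eqP; rewrite -subr_eq0; apply/eqP.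
have PhiE r s : 0 <= s <= L -> (v.1 + r * c s, v.2 + r * d s) = polar v (r0 s * r) (theta s).
  move=> sL; rewrite /c /d hpolar ?in_itv// /polar/=.
  by congr (_, _); ring.
(* Dividing [r] by [r0 s] brings the element into the form of a star with [r] in [[0, 1]]. *)
have DeltaE : Delta = [set y | exists s r, [/\ 0 <= s <= L, 0 <= r <= 1 &
    y = (v.1 + r * c s, v.2 + r * d s)]].
  rewrite hDelta; apply/seteqP; split => y [s [r [sL /andP[r_ge0 r1] ->]]].
    have r0s : 0 < r0 s by apply: rgt0; rewrite in_itv.
    exists s, (r / r0 s); split => //.
      by rewrite divr_ge0 ?(ltW r0s)//= ler_pdivrMr// mul1r.
    by rewrite PhiE// mulrC divfK// gt_eqF.
  have r0s : 0 < r0 s by apply: rgt0; rewrite in_itv.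
  exists s, (r0 s * r); split => //; last by rewrite PhiE.
  by rewrite mulr_ge0 ?(ltW r0s)//= ler_piMr// ltW.
have mDelta : measurable (Delta : set (measurableTypeR R * measurableTypeR R)).
  have := measurable_star v _ L (continuous_mesh_curve _ _ _ L0 Jcurve).
  congr measurable; rewrite DeltaE; apply/seteqP; split => y [s [r [sL r1 ->]]];
    by exists s, r; split => //; rewrite -/(G s) GE.
pose g y := ln (enorm (v - y)) * f y.
have -> : (\int[@lebesgue_measure2 R]_(y in Delta) (ln (enorm (v - y)) * f y)%R%:E =
    \int[@lebesgue_measure2 R]_(y in Delta) (g y)%:E)%E by [].
rewrite {1}DeltaE (star_integral_completed v L c d _ _ dirI cd0 dcE ddE cdc cdd); last 2 first.
- by rewrite -DeltaE.
- by rewrite -DeltaE.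
apply: eq_integral => s; rewrite inE/= => sI.
have sL : 0 <= s <= L by move: sI; rewrite in_itv.
congr (_ * _)%E; apply: eq_integral => r; rewrite inE/= in_itv/= => /andP[r_ge0 r1].
rewrite PhiE// /g; congr (ln _ * _ * _)%:E.
have r0s := rgt0 s sI.
(* The distance from [v] to the point of polar radius [r0 s * r] is this radius, also for [r = 0],
   so both logarithms have the same argument. *)
rewrite /enorm /polar/= !opprD !addrA !subrr !sub0r !sqrrN !exprMn -mulrDr.
by rewrite cos2Dsin2 mulr1 -exprMn sqrtr_sqr ger0_norm// mulr_ge0// ltW.
Qed.
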